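(* Let $T^n$ be the $n$-torus digraph. For all $1\le p\le n$, the canonical Hodge Laplacian $\Delta_p(T^n)$ satisfies $$\operatorname{spec}\Delta_p(T^n)=\Big\{\Big(\frac{3k}{p}\Big)_{2^k\binom nk\binom{n-1}{p-1}}\Big\}_{k=0}^{n}\ \sqcup\ \Big\{\Big(\frac{3k}{p+1}\Big)_{2^k\binom nk\binom{n-1}{p}}\Big\}_{k=0}^{n}.$$ In particular, $$\lambda_{\max}(\Delta_p(T^n))=\Big(\frac{3n}{p}\Big)_{2^n\binom{n-1}{p-1}}\quad\text{and}\quad\lambda_{\min}(\Delta_p(T^n))=0_{\binom{n}{p}}.$$
   Context: A digraph $G=(V,E)$ consists of a finite vertex set $V$ and a set $E$ of ordered pairs of distinct vertices (arrows), written $i\to j$. An elementary $p$-path ($p\ge 0$) is a sequence $i_0\dots i_p$ of vertices, with associated basis symbol $e_{i_0\dots i_p}$; it is regular if $i_{k-1}\ne i_k$ for all $k$, and allowed if $i_{k-1}\to i_k$ for all $k$. $\mathcal R_p$ is the real vector space with basis the regular elementary $p$-paths. The boundary operator $\partial:\mathcal R_p\to\mathcal R_{p-1}$ is $\partial e_{i_0\dots i_p}=\sum_{k=0}^p(-1)^k e_{i_0\dots\widehat{i_k}\dots i_p}$, where every non-regular term on the right is replaced by $0$; and $\mathcal R_{-1}=\{0\}$, $\partial e_i=0$. $\mathcal A_p\subset\mathcal R_p$ is the span of the allowed elementary $p$-paths ($\mathcal A_{-1}=\{0\}$), and $\Omega_p=\Omega_p(G)=\{u\in\mathcal A_p:\partial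 u\in\mathcal A_{p-1}\}$. Then $\partial\Omega_p\subset\Omega_{p-1}$ and $\partial^2=0$. Canonical Hodge Laplacian: equip $\mathcal R_p$ with the inner product for which the regular elementary paths are orthonormal, restrict it to $\Omega_p$, let $\partial^*:\Omega_{p-1}\to\Omega_p$ be the adjoint of $\partial:\Omega_p\to\Omega_{p-1}$, and put $\Delta_p(G)=\partial\partial^*+\partial^*\partial:\Omega_p\to\Omega_p$. The Cartesian product $X\Box Y$ of digraphs has vertex set $X\times Y$, with $(x_1,y_1)\to(x_2,y_2)$ iff either $x_1=x_2$ and $y_1\to y_2$, or $x_1\to x_2$ and $y_1=y_2$. The cyclic digraph $T$ has vertices $0,1,2$ and arrows $0\to1$, $1\to2$, $2\to0$; the $n$-torus is $T^n=T\Box\cdots\Box T$ ($n$ factors, $n\ge1$). $\operatorname{spec}A$ is the multiset of eigenvalues of the self-adjoint operator $A$, counted with multiplicity. $(\lambda)_m$ or $\lambda_m$ inside such a multiset (or as the value of $\lambda_{\max}$, $\lambda_{\min}$) means the value $\lambda$ with multiplicity $m$ (absent if $m=0$). $\sqcup$ is disjoint union of multisets (multiplicities add). $\lambda_{\max}(A)$, $\lambda_{\min}(A)$ are the maximal and minimal eigenvalues. *)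

(* Defs.v *)
From HB Require Import structures.
From mathcomp Require Import all_boot all_order all_algebra.
From mathcomp Require Import zify.
From mathcomp Require Import finmap multiset.
From mathcomp Require Import boolp classical_sets cardinality reals.

Set Implicit Arguments.
Unset Strict Implicit.
Unset Printing Implicit Defensive.

Import Order.TTheory GRing.Theory Num.Theory.
Local Open Scope mset_scope.
Local Open Scope ring_scope.

Record digraph := Digraph {
  vertex :> finType;
  arrow : rel vertex;
  arrow_irr : irreflexive arrow }.
Arguments arrow : clear implicits.

Definition box_arrow (X Y : digraph) : rel (X * Y) := fun u v =>
  ((u.1 == v.1) && arrow Y u.2 v.2) || (arrow X u.1 v.1 && (u.2 == v.2)).

Lemma box_arrow_irr (X Y : digraph) : irreflexive (@box_arrow X Y).
Proof. by move=> u; rewrite /box_arrow !arrow_irr andbF. Qed.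

Definition box (X Y : digraph) : digraph := Digraph (@box_arrow_irr X Y).

Definition cyc3_arrow : rel 'I_3 := fun i j => (j == i.+1 %% 3 :> nat)%N.

Lemma cyc3_arrow_irr : irreflexive cyc3_arrow.
Proof. by case=> [[|[|[|i]]] Hi]. Qed.

Definition cyc3 : digraph := Digraph cyc3_arrow_irr.

(* torus n is cyc3 [box] ... [box] cyc3 with n factors, for n >= 1;
   torus 0 is a junk value *)
Definition torus (n : nat) : digraph := iter n.-1 (fun X => box X cyc3) cyc3.

Section Chains.
Variables (R : realType) (G : digraph).

Definition regular (s : seq G) : bool := sorted (fun i j => i != j) s.
Definition allowed (s : seq G) : bool := sorted (arrow G) s.

(* regular elementary p-paths i_0 ... i_p *)
Definition rpath (p : nat) : predArgType := {s : p.+1.-tuple G | regular s}.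

(* R^o is the real line viewed as a vector space over itself *)
Definition chain (p : nat) := {ffun rpath p -> R^o}.

(* The basis symbol e_s; by construction it is 0 when s is not a regular
   p-path (in particular when s does not consist of p + 1 vertices). *)
Definition epath (p : nat) (s : seq G) : chain p :=
  [ffun x : rpath p => ((val (val x) == s)%:R : R^o)].

(* s with the vertex of index k omitted *)
Definition omit (k : nat) (s : seq G) : seq G := take k s ++ drop k.+1 s.

Lemma size_omit (k : nat) (s : seq G) :
  (k < size s)%N -> size (omit k s) = (size s).-1.
Proof. by move=> ks; rewrite size_cat size_drop size_takel; lia. Qed.

Lemma nth_omit (a : G) (k j : nat) (s : seq G) :
  (k < size s)%N -> nth a (omit k s) j = nth a s (bump k j).
Proof.
move=> ks; rewrite /omit nth_cat size_takel; last by lia.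
rewrite /bump; case: ltnP => jk; first by rewrite nth_take.
by rewrite nth_drop; congr nth; lia.
Qed.

Definition bd_fun (p : nat) (u : chain p) : chain p.-1 :=
  \sum_(x : rpath p)
    (u x : R) *: \sum_(k < p.+1) (-1) ^+ k *: epath p.-1 (omit k (val (val x))).

Lemma bd_fun_is_linear (p : nat) : linear (@bd_fun p).
Proof.
move=> a u v; rewrite /bd_fun scaler_sumr -big_split /=.
by apply: eq_bigr => x _; rewrite !ffunE scalerDl -scalerA.
Qed.

HB.instance Definition _ (p : nat) :=
  GRing.isLinear.Build R (chain p) (chain p.-1) _ (@bd_fun p)
    (@bd_fun_is_linear p).

(* The boundary R_p -> R_{p-1}. For p = 0 it is the zero map of R_0
   (epath 0 [::] = 0), which stands for the zero map R_0 -> R_{-1} = {0}. *)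
Definition bd (p : nat) : 'Hom(chain p, chain p.-1) := linfun (@bd_fun p).

Lemma bd_epath (p : nat) (s : seq G) : size s = p.+1 ->
  bd p (epath p s) =
  \sum_(k < p.+1) (-1) ^+ k *: epath p.-1 (omit k s) :> chain p.-1.
Proof.
move=> szs; case: (boolP (regular s)) => [s_reg|].
  have tP : size s == p.+1 by apply/eqP.
  pose x0 : rpath p :=
    exist (fun t : p.+1.-tuple G => regular t) (Tuple tP) s_reg.
  rewrite lfunE /= /bd_fun (bigD1 x0) //= ffunE eqxx scale1r.
  rewrite [X in _ + X]big1 ?addr0 // => x.
  move=> xx0; rewrite ffunE; case: eqP => [xs|_]; last by rewrite scale0r.
  by case/eqP: xx0; apply/val_inj/val_inj.
move=> s_nreg; rewrite (_ : epath p s = 0) ?linear0; last first.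
  apply/ffunP => x; rewrite !ffunE; case: eqP => // xs.
  by case/negP: s_nreg; rewrite -xs; exact: valP x.
case: s szs s_nreg => // a s szs.
move=> /(sortedP a) s_nreg.
have [i [ltis /negP/negPn/eqP eqi]] : exists i, (i.+1 < size (a :: s))%N /\
    ~ nth a (a :: s) i != nth a (a :: s) i.+1.
  apply: contrapT => H; apply: s_nreg => i ilt; apply: contrapT => H'.
  by apply: H; exists i.
move: (a :: s) {s_nreg} szs ltis eqi => {}s szs ltis eqi.
have i_lt : (i < p.+1)%N by rewrite -szs ltnW.
have i1_lt : (i.+1 < p.+1)%N by rewrite -szs.
have i1i : Ordinal i1_lt != Ordinal i_lt.
  by rewrite -val_eqE /= gtn_eqF.
rewrite (bigD1 (Ordinal i_lt)) //= (bigD1 (Ordinal i1_lt)) //= big1 => [|k].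
  have -> : omit i s = omit i.+1 s.
    apply: (@eq_from_nth _ a) => [|j]; first by rewrite !size_omit ?szs.
    rewrite size_omit ?szs // => _; rewrite !nth_omit ?szs //.
    rewrite /bump; have [<-|ne] := eqVneq i j.
      by rewrite leqnn ltnn add1n.
    by rewrite [RHS](_ : _ = nth a s ((i <= j) + j)%N) // ltn_neqAle ne.
  by rewrite addr0 exprS mulN1r scaleNr addrN.
case/andP; rewrite -!val_eqE /= => /eqP ki /eqP ki1.
rewrite (_ : epath _ _ = 0) ?scaler0 //.
apply/ffunP => x; rewrite !ffunE; case: eqP => // xs.
have /(sortedP a) x_reg := valP x; exfalso.
have kp : (k < size s)%N by rewrite szs.
move: x_reg; rewrite xs size_omit // szs /= => x_reg.
have [ltki|leik] := ltnP k i.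
  have := x_reg i.-1; rewrite !nth_omit // /bump.
  rewrite (_ : (k <= i.-1) = true)%N; last by lia.
  rewrite (_ : (k <= i.-1.+1) = true)%N; last by lia.
  rewrite !add1n (_ : i.-1.+1 = i) ?eqi ?eqxx; last by lia.
  by move/(_ i1_lt).
have := x_reg i; rewrite !nth_omit // /bump.
rewrite (_ : (k <= i) = false)%N; last by lia.
rewrite (_ : (k <= i.+1) = false)%N; last by lia.
rewrite !add0n eqi eqxx => H.
suff: (i.+1 < p)%N by move/H.
by have := ltn_ord k; lia.
Qed.

Lemma bdK0 (p : nat) (u : chain p) : bd p.-1 (bd p u) = 0.
Proof.
have bd0 (v : chain 0) : bd 0 v = 0.
  rewrite lfunE /= /bd_fun big1 // => x _; rewrite big1 ?scaler0 // => k _.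
  rewrite (_ : epath _ _ = 0) ?scaler0 //; apply/ffunP => y; rewrite !ffunE.
  case: eqP => // /(congr1 size).
  by rewrite size_tuple size_omit ?size_tuple.
case: p u => [|[|p]] u; rewrite ?bd0 //=.
rewrite [bd _ u]lfunE /= /bd_fun linear_sum big1 // => x _.
rewrite linearZ /= linear_sum /=.
rewrite (_ : \sum_(k < _) _ = 0) ?scaler0 //.
move: (val (val x)) (size_tuple (val x)) => {u x} s szs.
pose t (k l : nat) : chain p := (-1) ^+ (k + l) *: epath p (omit l (omit k s)).
rewrite (eq_bigr (fun k : 'I_p.+3 => \sum_(l < p.+2) t k l)); last first.
  move=> k _; rewrite linearZ /= bd_epath ?size_omit ?szs // scaler_sumr.
  by apply: eq_bigr => l _; rewrite scalerA -exprD.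
rewrite pair_big /=.
pose sg (z : 'I_p.+3 * 'I_p.+2) : 'I_p.+3 * 'I_p.+2 :=
  if (z.2 < z.1)%N then (inord z.2, inord z.1.-1) else (inord z.2.+1, inord z.1).
have sgK : involutive sg.
  case=> k l; rewrite /sg /=.
  have [lk|kl] := ltnP l k => /=.
    rewrite !inordK; try by have := ltn_ord k; have := ltn_ord l; lia.
    rewrite (_ : (k.-1 < l) = false)%N; last by lia.
    by rewrite prednK ?inord_val //; lia.
  rewrite !inordK; try by have := ltn_ord k; have := ltn_ord l; lia.
  by rewrite ltnS kl /= !inord_val.
have tsg z : t (sg z).1 (sg z).2 = - t z.1 z.2.
  have omC k l : (l < k)%N -> (k < p.+3)%N ->
      omit k.-1 (omit l s) = omit l (omit k s).
    move=> lk kp; case: s szs {t} => // a r szs.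
    apply: (@eq_from_nth _ a) => [|j]; rewrite ?size_omit ?szs //=; try by lia.
    move=> jp; rewrite !nth_omit ?size_omit ?szs //; try by lia.
    by congr nth; rewrite /bump; lia.
  case: z => k l; rewrite /sg /=; have := ltn_ord k; have := ltn_ord l.
  have [lk|kl] := ltnP l k => /= Hl Hk; rewrite !inordK; try by lia.
    rewrite /t omC // -scaleNr; congr (_ *: _).
    rewrite (_ : k + l = (l + k.-1).+1)%N; last by lia.
    by rewrite exprS mulN1r opprK.
  rewrite /t -scaleNr -(omC l.+1 k) //; congr (_ *: _).
  by rewrite addSn exprS mulN1r addnC.
set S := \sum_z _.
have SN : S = - S.
  rewrite {1}/S (reindex_inj (inv_inj sgK)) /= -sumrN.
  by apply: eq_bigr => z _; rewrite tsg.
apply/eqP; have : (2 : R) *: S == 0 by rewrite scaler_nat mulr2n {2}SN addrN.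
by rewrite scaler_eq0 pnatr_eq0.
Qed.

Definition Aspace (p : nat) : {vspace chain p} :=
  <<[seq epath p (val (val x)) | x <- enum (rpath p)
                               & allowed (val (val x))]>>%VS.

Definition Omega (p : nat) : {vspace chain p} :=
  (Aspace p :&: bd p @^-1: Aspace p.-1)%VS.

Definition dot (p : nat) (u v : chain p) : R := \sum_(x : rpath p) u x * v x.

Section Dot.
Variable p : nat.
Implicit Types u v w : chain p.

Lemma dotC u v : dot u v = dot v u.
Proof. by apply: eq_bigr => x _; rewrite mulrC. Qed.

Lemma dot_linear u : linear (dot u : chain p -> R^o).
Proof.
move=> a v w; rewrite /dot scaler_sumr -big_split /=.
by apply: eq_bigr => x _; rewrite !ffunE mulrDr mulrCA.
Qed.

HB.instance Definition _ u :=
  GRing.isLinear.Build R (chain p) R^o _ (dot u : chain p -> R^o)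
    (dot_linear u).

Lemma dotDr u v w : dot u (v + w) = dot u v + dot u w.
Proof. exact: (linearD (dot u : chain p -> R^o)). Qed.

Lemma dotBr u v w : dot u (v - w) = dot u v - dot u w.
Proof. exact: (linearB (dot u : chain p -> R^o)). Qed.

Lemma dotZr a u v : dot u (a *: v) = a * dot u v.
Proof. by rewrite (linearZ_LR (dot u : chain p -> R^o)). Qed.

Lemma dotDl u v w : dot (v + w) u = dot v u + dot w u.
Proof. by rewrite !(dotC _ u) dotDr. Qed.

Lemma dot_eq0 u : dot u u = 0 -> u = 0.
Proof.
move/eqP; rewrite psumr_eq0 => [|x _]; last exact: sqr_ge0.
move/allP => u0; apply/ffunP => x; rewrite ffunE.
by have := u0 x (mem_index_enum x); rewrite /= mulf_eq0 orbb => /eqP.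
Qed.

End Dot.

(* Every linear form on a subspace U of R_p is represented by the inner
   product with a vector of U. *)
Lemma riesz (p : nat) (U : {vspace chain p})
    (phi : {linear subvs_of U -> R^o}) :
  exists w : subvs_of U, forall u, phi u = dot (vsval u) (vsval w).
Proof.
pose j (w : subvs_of U) : 'Hom(subvs_of U, R^o) :=
  linfun ((dot (vsval w) : chain p -> R^o) \o vsval).
have jE w u : j w u = dot (vsval u) (vsval w) by rewrite lfunE /= dotC.
have j_linear : linear j.
  move=> a v w; apply/lfunP => u; rewrite add_lfunE scale_lfunE !jE.
  by rewrite raddfD linearZ /= dotZr.
pose j_lin := GRing.isLinear.Build R (subvs_of U) 'Hom(subvs_of U, R^o) _ j
  j_linear.
pose jL : {linear subvs_of U -> 'Hom(subvs_of U, R^o)} := HB.pack j j_lin.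
have kerJ : lker (linfun jL) == 0%VS.
  apply/lker0P => v w; rewrite !lfunE /= => /lfunP/(_ (v - w)).
  rewrite !jE => /eqP; rewrite -subr_eq0.
  rewrite -dotBr -raddfB /=.
  by move=> /eqP/dot_eq0/subr0_eq/val_inj.
have imJ : (limg (linfun jL) == fullv)%VS.
  rewrite eqEdim subvf /= limg_dim_eq; last by rewrite (eqP kerJ) capv0.
  by rewrite !dimvf /dim /= muln1.
have: linfun phi \in limg (linfun jL) by rewrite (eqP imJ) memvf.
case/memv_imgP => w _ phiE; exists w => u.
by rewrite -jE -[phi u]lfunE phiE lfunE.
Qed.

Definition is_adjoint (p q : nat) (U : {vspace chain p})
    (W : {vspace chain q}) (f : 'Hom(subvs_of U, subvs_of W))
    (g : 'Hom(subvs_of W, subvs_of U)) : Prop :=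
  forall u w, dot (vsval (f u)) (vsval w) = dot (vsval u) (vsval (g w)).

Lemma adjoint_exists (p q : nat) (U : {vspace chain p})
    (W : {vspace chain q}) (f : 'Hom(subvs_of U, subvs_of W)) :
  exists g, is_adjoint f g.
Proof.
pose phi (w : subvs_of W) : {linear subvs_of U -> R^o} :=
  (dot (vsval w) : chain q -> R^o) \o (vsval \o f).
have [g gE] := choice (fun w => riesz (phi w)).
have gdot w u : dot (vsval u) (vsval (g w)) = dot (vsval (f u)) (vsval w).
  by rewrite -gE /= dotC.
have g_linear : linear g.
  move=> a v w; apply/subr0_eq; set z := _ - _.
  have zE : vsval z =
      vsval (g (a *: v + w)) - (a *: vsval (g v) + vsval (g w)) by [].
  apply/val_inj/dot_eq0; change (dot (vsval z) (vsval z) = 0).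
  rewrite {2}zE dotBr dotDr dotZr !gdot -[vsval (_ *: v + w)]/(_ *: _ + _).
  by rewrite dotDr dotZr subrr.
pose g_lin := GRing.isLinear.Build R (subvs_of W) (subvs_of U) _ g g_linear.
pose gL : {linear subvs_of W -> subvs_of U} := HB.pack g g_lin.
by exists (linfun gL) => u w; rewrite lfunE /= gdot.
Qed.

Definition adjoint (p q : nat) (U : {vspace chain p})
    (W : {vspace chain q}) (f : 'Hom(subvs_of U, subvs_of W)) :
    'Hom(subvs_of W, subvs_of U) :=
  projT1 (cid (adjoint_exists f)).

Lemma adjointP (p q : nat) (U : {vspace chain p})
    (W : {vspace chain q}) (f : 'Hom(subvs_of U, subvs_of W)) :
  is_adjoint f (adjoint f).
Proof. exact: (projT2 (cid (adjoint_exists f))). Qed.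

(* The restriction Omega_p -> Omega_{p-1} of the boundary; vsproj only serves
   as the corestriction, see OmegabdE. *)
Definition Omegabd (p : nat) :
    'Hom(subvs_of (Omega p), subvs_of (Omega p.-1)) :=
  linfun (vsproj (Omega p.-1) \o bd p \o vsval).

Lemma bd_Omega (p : nat) (u : chain p) :
  u \in Omega p -> bd p u \in Omega p.-1.
Proof.
rewrite !memv_cap -!memv_preim => /andP[_ uA].
by rewrite uA bdK0 mem0v.
Qed.

Lemma OmegabdE (p : nat) (u : subvs_of (Omega p)) :
  vsval (Omegabd p u) = bd p (vsval u).
Proof. by rewrite lfunE /= vsprojK // bd_Omega ?subvsP. Qed.

Definition hodge (p : nat) : 'End(subvs_of (Omega p)) :=
  ((Omegabd p.+1 \o adjoint (Omegabd p.+1))%VF : 'End(subvs_of (Omega p)))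
  + (adjoint (Omegabd p) \o Omegabd p)%VF.

Lemma hodge_sym (p : nat) : is_adjoint (hodge p) (hodge p).
Proof.
move=> u w; rewrite !add_lfunE !comp_lfunE /= dotDl dotDr.
rewrite (adjointP (Omegabd p.+1)) -(adjointP (Omegabd p)).
rewrite [in RHS](dotC (vsval u)) (adjointP (Omegabd p.+1)).
rewrite [in LHS](dotC _ (vsval w)) -(adjointP (Omegabd p)).
by congr (_ + _); rewrite dotC.
Qed.

End Chains.

Section Spectrum.
Variables (R : realType) (vT : vectType R).
Implicit Types (A : 'End(vT)) (M : {mset R}).

(* The eigenvalues of A, each counted with the dimension of its eigenspace
   (the algebraic multiplicity as well when A is self-adjoint). *)
Definition spec A : {mset R} :=
  [fsfun a in fset_set [set a : R | passmx.leigenvalue A a]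
     => \dim (passmx.leigenspace A a)].

Lemma finite_leigenvalue A : finite_set [set a : R | passmx.leigenvalue A a].
Proof.
have eb := vbasisP {:vT}.
set m := passmx.mxof (vbasis {:vT}) (vbasis {:vT}) A.
apply: contrapT => /(infinite_set_fset (size (char_poly m))) [B BA].
rewrite leqNgt => /negP; apply.
apply: (@max_poly_roots _ (char_poly m) (enum_fset B)).
- exact/monic_neq0/char_poly_monic.
- apply/allP => a /BA /=; rewrite /passmx.leigenvalue.
  rewrite (passmx.leigenspaceE eb) passmx.vsof_eq0 //.
  by rewrite -eigenvalue_root_char.
- exact: fset_uniq.
Qed.

Lemma specE A a : spec A a = \dim (passmx.leigenspace A a).
Proof.
rewrite /spec fsfunE in_fset_set; last exact: finite_leigenvalue.
case: ifPn => // /negP; rewrite inE /= /passmx.leigenvalue => /negP.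
by rewrite negbK => /eqP ->; rewrite dimv0.
Qed.

(* m is the multiplicity of the extremal eigenvalue a *)
Definition lambda_max_is A (a : R) (m : nat) : Prop :=
  [/\ passmx.leigenvalue A a, forall b, passmx.leigenvalue A b -> b <= a & spec A a = m].

Definition lambda_min_is A (a : R) (m : nat) : Prop :=
  [/\ passmx.leigenvalue A a, forall b, passmx.leigenvalue A b -> a <= b & spec A a = m].

End Spectrum.

(* Main.v *)
From HB Require Import structures.
Require Import Defs.
From mathcomp Require Import all_boot all_order all_algebra.
From mathcomp Require Import finmap multiset.
From mathcomp Require Import reals.
From mathcomp Require Import ring lra.

Import Order.TTheory GRing.Theory Num.Theory.

Set Implicit Arguments.
Unset Strict Implicit.
Unset Printing Implicit Defensive.

Local Open Scope mset_scope.
Local Open Scope ring_scope.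

(** The torus T^n is the Cayley digraph of the group L = (Z/3)^n for the unit
vectors e_1, ..., e_n, so an allowed p-path is a pair (y, J) of a starting
point y in L and a word J of length p in the directions 1, ..., n.  Deleting an
interior vertex replaces two consecutive steps e_a, e_b by the single step
e_a + e_b, which is never 0 nor a unit vector, and which determines {a, b}
and its position in the path.  A chain u of allowed paths therefore has an
allowed boundary if and only if its coefficients u(y; J) are alternating in J
[mem_Omega]: Omega_p is the space of functions on L with values in the
alternating p-forms on R^n.

In these coordinates [path_coef_bd, path_coef_adjoint]
- (bd u)(y; I) = sum_j (u(y - e_j; jI) - u(y; jI)), the contraction with the
  vector of commuting difference operators D_j;
- p bd^* is the wedge product with the adjoint differences, the factor p coming
  from the fact that Omega_p carries the norm of functions of words and not of
  functions of p-subsets.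

Put A_p = (p + 1) bd bd^* and B_p = p bd^* bd on Omega_p.  The Clifford relation
between contraction and wedge makes the mixed terms cancel and leaves
A_p + B_p = sum_j D_j^* D_j, acting on the variable y only: it is the
Laplacian of the lattice L [path_coef_lap].  The latter is diagonalised by
products of one-dimensional waves, with eigenvalue three times the number of
nonconstant factors, hence with multiplicity 2^k C(n, k) for the eigenvalue 3k;
on Omega_p all multiplicities are multiplied by C(n, p) [dim_leigenspace_lap].

The rest is linear algebra.  Since bd^2 = 0, the products A_p B_p and B_p A_p
vanish, so that for a nonzero a the a-eigenspace of A_p + B_p is the direct
sum of those of A_p and B_p.  Moreover B_(p+1) = (p + 1) bd^* bd and
A_p = (p + 1) bd bd^* have the same nonzero eigenvalues with the same
multiplicities.  By induction on p and Pascal's rule, a nonzero 3k has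
multiplicity 2^k C(n, k) C(n-1, p) in A_p, and multiplicity
2^k C(n, k) C(n-1, p-1) in B_p [dim_leigenspace_torus_up].  Finally
Delta_p = A_p / (p + 1) + B_p / p, whose kernel is the kernel of A_p + B_p. *)

(** * Eigenspaces *)

Lemma mem_leigenspace (K : fieldType) (vT : vectType K) (f : 'End(vT)) (a : K)
    (v : vT) : (v \in passmx.leigenspace f a) = (f v == a *: v).
Proof.
by rewrite memv_ker add_lfunE opp_lfunE scale_lfunE id_lfunE subr_eq0.
Qed.

Lemma dimv_leq_inj (K : fieldType) (vT wT : vectType K) (h : 'Hom(vT, wT))
    (U : {vspace vT}) (W : {vspace wT}) :
  {in U, forall v, h v \in W} -> {in U, forall v, h v = 0 -> v = 0} ->
  (\dim U <= \dim W)%N.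
Proof.
move=> hUW hinj.
have /limg_dim_eq <- : (U :&: lker h = 0)%VS.
  apply/eqP; rewrite -subv0; apply/subvP => v.
  by rewrite memv_cap memv_ker memv0 => /andP[vU /eqP/(hinj _ vU)->].
by apply/dimvS/subvP => w /memv_imgP[v vU ->]; exact: hUW.
Qed.

Lemma dim_leigenspace_conj (K : fieldType) (vT wT : vectType K)
    (h : 'Hom(vT, wT)) (f : 'End(vT)) (g : 'End(wT)) (a : K) :
  injective h -> (forall w, exists v, h v = w) ->
  (forall v, h (f v) = g (h v)) ->
  \dim (passmx.leigenspace f a) = \dim (passmx.leigenspace g a).
Proof.
move=> hinj hsurj hfg.
suff <- : (h @: passmx.leigenspace f a)%VS = passmx.leigenspace g a.
  have /eqP kh : lker h == 0%VS by apply/lker0P.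
  by rewrite limg_dim_eq // kh capv0.
apply/vspaceP => w; rewrite mem_leigenspace; apply/memv_imgP/eqP.
  by case=> v; rewrite mem_leigenspace => /eqP fv ->; rewrite -hfg fv linearZ.
have [v <-] := hsurj w => gv; exists v => //; rewrite mem_leigenspace.
by apply/eqP/hinj; rewrite hfg gv linearZ.
Qed.

(** The map f sends an eigenvector of g f to an eigenvector of f g, and kills none
for a nonzero eigenvalue. *)
Lemma dim_leigenspace_comp (K : fieldType) (vT wT : vectType K)
    (f : 'Hom(vT, wT)) (g : 'Hom(wT, vT)) (a : K) : a != 0 ->
  \dim (passmx.leigenspace (g \o f)%VF a)
  = \dim (passmx.leigenspace (f \o g)%VF a).
Proof.
move=> a0.
suff le (vT' wT' : vectType K) (f' : 'Hom(vT', wT')) (g' : 'Hom(wT', vT')) :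
    (\dim (passmx.leigenspace (g' \o f')%VF a)
      <= \dim (passmx.leigenspace (f' \o g')%VF a))%N.
  by apply/eqP; rewrite eqn_leq !le.
apply: (@dimv_leq_inj _ _ _ f') => v; rewrite !mem_leigenspace !comp_lfunE.
  by move=> /eqP ->; rewrite linearZ.
move=> /eqP gf fv; move: gf; rewrite fv linear0 => /esym/eqP.
by rewrite scaler_eq0 (negPf a0) => /eqP.
Qed.

Lemma leigenspaceZ (K : fieldType) (vT : vectType K) (f : 'End(vT)) (a c : K) :
  c != 0 -> passmx.leigenspace (c *: f) a = passmx.leigenspace f (a / c).
Proof.
move=> c0; apply/vspaceP => v; rewrite !mem_leigenspace scale_lfunE.
apply/eqP/eqP => [|->]; last by rewrite scalerA mulrC divfK.
move=> /(congr1 (fun w => c^-1 *: w)).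
by rewrite !scalerA mulVf // scale1r mulrC.
Qed.

(** If (f + g) v = a v, then applying f and g shows that f v / a and g v / a are
eigenvectors of f and g, and their sum is v. *)
Lemma dim_leigenspaceD (K : fieldType) (vT : vectType K) (f g : 'End(vT))
    (a : K) : a != 0 ->
  (forall v, f (g v) = 0) -> (forall v, g (f v) = 0) ->
  \dim (passmx.leigenspace (f + g) a)
  = (\dim (passmx.leigenspace f a) + \dim (passmx.leigenspace g a))%N.
Proof.
move=> a0 fg gf.
have ker_of (h k : 'End(vT)) v : (forall v, k (h v) = 0) ->
    v \in passmx.leigenspace h a -> k v = 0.
  move=> kh; rewrite mem_leigenspace => /eqP hv.
  have := kh v; rewrite hv linearZ => /eqP.
  by rewrite scaler_eq0 (negPf a0) => /eqP.
rewrite -dimv_disjoint_sum.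
  congr (\dim _); apply/vspaceP => v.
  rewrite mem_leigenspace add_lfunE; apply/eqP/memv_addP => [fgv|].
    exists (a^-1 *: f v).
      rewrite mem_leigenspace linearZ /= scalerA divff // scale1r.
      have := congr1 f fgv; rewrite linearD linearZ /= fg addr0 => ->.
      by rewrite scalerA mulVf // scale1r.
    exists (a^-1 *: g v).
      rewrite mem_leigenspace linearZ /= scalerA divff // scale1r.
      have := congr1 g fgv; rewrite linearD linearZ /= gf add0r => ->.
      by rewrite scalerA mulVf // scale1r.
    by rewrite -scalerDr fgv scalerA mulVf // scale1r.
  case=> x xf [y yg ->]; rewrite !linearD /=.
  rewrite (ker_of f g x) // (ker_of g f y) // addr0 add0r.
  by move: xf yg; rewrite !mem_leigenspace => /eqP -> /eqP ->.
apply/eqP; rewrite -subv0; apply/subvP => v; rewrite memv_cap memv0.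
move=> /andP[vf vg]; have := ker_of g f v fg vg.
move: vf; rewrite mem_leigenspace => /eqP -> /eqP.
by rewrite scaler_eq0 (negPf a0).
Qed.

Lemma dim_leigenspace_diag (K : fieldType) (T : finType) (mu : T -> K)
    (f : 'End({ffun T -> K^o})) (a : K) :
  (forall w t, f w t = mu t * w t) ->
  \dim (passmx.leigenspace f a) = #|[set t | mu t == a]|.
Proof.
move=> fE; pose sT := {t | mu t == a}.
(* The eigenspace is the space of functions supported on the level set of mu. *)
pose res (w : {ffun T -> K^o}) : {ffun sT -> K^o} := [ffun t => w (val t)].
have res_lin : linear res by move=> c v w; apply/ffunP => t; rewrite !ffunE.
pose resL := GRing.isLinear.Build _ _ _ _ res res_lin.
pose r : {linear {ffun T -> K^o} -> {ffun sT -> K^o}} := HB.pack res resL.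
have memE w : (w \in passmx.leigenspace f a)
    = [forall t, (mu t != a) ==> (w t == 0)].
  rewrite mem_leigenspace; apply/eqP/forallP => [fw t|w0].
    apply/implyP => mut; have /ffunP/(_ t) := fw; rewrite fE ffunE => /eqP.
    rewrite -subr_eq0 -[a *: _]/(a * _) -mulrBl mulf_eq0 subr_eq0.
    by rewrite (negPf mut).
  apply/ffunP => t; rewrite fE ffunE; have := w0 t.
  by case: eqP => [->|_ /= /eqP ->]; rewrite //= mulr0 scaler0.
have -> : \dim (passmx.leigenspace f a)
    = \dim (linfun r @: passmx.leigenspace f a)%VS.
  apply/esym/limg_dim_eq/eqP; rewrite -subv0; apply/subvP => w.
  rewrite memv_cap memv_ker memE memv0 lfunE => /andP[/forallP w0 /eqP rw].
  apply/eqP/ffunP => t; rewrite ffunE; have := w0 t.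
  case: eqP => [mut _|_ /= /eqP//].
  have /ffunP/(_ (exist (fun t => mu t == a) t (introT eqP mut))) := rw.
  by rewrite !ffunE.
suff -> : (linfun r @: passmx.leigenspace f a)%VS = fullv.
  by rewrite dimvf /dim /= muln1 card_sig cardsE.
apply/eqP; rewrite eqEsubv subvf /=; apply/subvP => w _.
pose ext : {ffun T -> K^o} :=
  [ffun t => if @insub _ (fun t => mu t == a) sT t is Some s then w s else 0].
apply/memv_imgP; exists ext.
  rewrite memE; apply/forallP => t; apply/implyP => mut.
  by rewrite ffunE insubN.
rewrite (lfunE r) /=; apply/ffunP => t; rewrite !ffunE.
by case: insubP => [s _ /val_inj -> //|]; rewrite (valP t).
Qed.

(** * Alternating functions of words *)

Fixpoint swap (T : Type) (k : nat) (s : seq T) : seq T :=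
  match k, s with
  | 0, a :: b :: s' => b :: a :: s'
  | k'.+1, a :: s' => a :: swap k' s'
  | _, _ => s
  end.

Lemma size_swap (T : Type) (k : nat) (s : seq T) : size (swap k s) = size s.
Proof. by elim: k s => [[|a [|b s]]|k IHk [|a s]] //=; rewrite IHk. Qed.

Lemma swapK (T : Type) (k : nat) : involutive (@swap T k).
Proof. by elim: k => [[|a [|b s]]|k IHk [|a s]] //=; rewrite IHk. Qed.

Lemma perm_swap (T : eqType) (k : nat) (s : seq T) : perm_eq (swap k s) s.
Proof.
elim: k s => [[|a [|b s]]|k IHk [|a s]] //=; last by rewrite perm_cons.
by rewrite -[_ :: _ :: _]/([:: b; a] ++ s) -[a :: b :: s]/([:: a; b] ++ s)
  perm_cat2r (perm_catC [:: b] [:: a]).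
Qed.

Canonical swap_tuple (T : Type) (p k : nat) (t : p.-tuple T) :=
  @Tuple p T (swap k t) (introT eqP (etrans (size_swap k t) (size_tuple t))).

(** The condition is required for equal neighbours as well: over a ring without
2-torsion it then says that the value is 0. *)
Definition alternating (T : Type) (V : zmodType) (f : seq T -> V) : Prop :=
  forall k s, (k.+1 < size s)%N -> f (swap k s) = - f s.

Section Alternating.
Variables (T : Type) (V : zmodType).
Implicit Types (f : seq T -> V) (h : T -> seq T -> V).

Lemma alternating_cons f a : alternating f -> alternating (fun s => f (a :: s)).
Proof. by move=> f_alt k s ks; rewrite -(f_alt k.+1). Qed.

Lemma alternating_move f s1 a s2 : alternating f ->
  f (s1 ++ a :: s2) = f (a :: s1 ++ s2) *~ ((-1) ^+ size s1).
Proof.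
elim: s1 f => [|b s1 IHs] f f_alt; first by rewrite mulr1z.
rewrite cat_cons (IHs (fun s => f (b :: s))); last exact: alternating_cons.
by rewrite (f_alt 0%N [:: a, b & s1 ++ s2]) // exprS mulN1r mulrNz mulNrz.
Qed.

(** [del h s] is the alternating sum over the positions i of s of the
values h s_i (s without s_i): for 1-forms h with alternating values this is,
up to normalisation, the exterior product of forms. The recursion absorbs the
signs. *)
Fixpoint del h s : V :=
  if s is a :: s' then h a s' - del (fun b r => h b (a :: r)) s' else 0.

Lemma eq_del h1 h2 s :
  (forall a r, (size r).+1 = size s -> h1 a r = h2 a r) -> del h1 s = del h2 s.
Proof.
elim: s h1 h2 => [|a s IHs] h1 h2 //= h12; rewrite h12 //; congr (_ - _).
by apply: IHs => b r rs; rewrite h12 //= rs.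
Qed.

Lemma delD h1 h2 s : del (fun a r => h1 a r + h2 a r) s = del h1 s + del h2 s.
Proof.
by elim: s h1 h2 => [|a s IHs] h1 h2 /=; rewrite ?addr0 // IHs opprD addrACA.
Qed.

Lemma delN h s : del (fun a r => - h a r) s = - del h s.
Proof. by elim: s h => [|a s IHs] h /=; rewrite ?oppr0 // IHs opprD. Qed.

Lemma del_sum (I : finType) (h : I -> T -> seq T -> V) s :
  del (fun a r => \sum_i h i a r) s = \sum_i del (h i) s.
Proof.
elim: s h => [|a s IHs] h /=; first by rewrite big1.
by rewrite IHs sumrB.
Qed.

Lemma alternating_del h : (forall a, alternating (h a)) -> alternating (del h).
Proof.
move=> h_alt k; elim: k h h_alt => [|k IHk] h h_alt [|a s] //=.
  case: s => //= b s _.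
  have -> : del (fun c r => h c (b :: a :: r)) s
          = - del (fun c r => h c (a :: b :: r)) s.
    by rewrite -delN; apply: eq_del => c r _; rewrite -(h_alt c 0%N).
  by rewrite opprK [RHS]opprB opprD addrA addrAC.
move=> ks; rewrite h_alt // IHk //.
  by rewrite opprB opprK addrC.
by move=> b; exact: alternating_cons.
Qed.

End Alternating.

Lemma sum_tuple_cons (T : finType) (V : zmodType) (p : nat) (F : seq T -> V) :
  \sum_(t : p.+1.-tuple T) F t = \sum_a \sum_(t : p.-tuple T) F (a :: t).
Proof.
rewrite pair_bigA /= (reindex (fun z : T * p.-tuple T => [tuple of z.1 :: z.2])) //.
exists (fun t => (thead t, [tuple of behead t])) => [[a t] _|t _] /=.
  by congr pair; apply: val_inj.
by rewrite [RHS]tuple_eta; apply: val_inj.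
Qed.

Lemma sum_tuple_rcons (T : finType) (V : zmodType) (p : nat) (F : seq T -> V) :
  \sum_(t : p.+1.-tuple T) F t = \sum_(t : p.-tuple T) \sum_a F (rcons t a).
Proof.
elim: p F => [|p IHp] F.
  rewrite sum_tuple_cons [RHS]exchange_big /=.
  by apply: eq_bigr => a _; apply: eq_bigr => t _; rewrite (tuple0 t).
rewrite sum_tuple_cons (sum_tuple_cons _ (fun s => \sum_a F (rcons s a))).
by apply: eq_bigr => a _; rewrite (IHp (fun s => F (a :: s))).
Qed.

(** Every position of the word contributes the same sum, because the letter can be
moved to the front of f at the cost of the sign with which it occurs in
[del]. *)
Lemma sum_mul_del (T : finType) (R : pzRingType) (p : nat) (f : seq T -> R)
    (h : T -> seq T -> R) : alternating f ->
  \sum_(t : p.+1.-tuple T) f t * del h t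
  = (\sum_a \sum_(t : p.-tuple T) f (a :: t) * h a t) *+ p.+1.
Proof.
elim: p f h => [|p IHp] f h f_alt.
  rewrite mulr1n (sum_tuple_cons _ (fun s => f s * del h s)) /=.
  apply: eq_bigr => a _; apply: eq_bigr => t _.
  by rewrite (tuple0 t) /= subr0.
rewrite (sum_tuple_cons _ (fun s => f s * del h s)) /=.
transitivity (\sum_a \sum_(t : p.+1.-tuple T) f (a :: t) * h a t
    - \sum_a \sum_b \sum_(t : p.-tuple T) (f [:: a, b & t] * h b (a :: t)) *+ p.+1).
  rewrite -sumrB; apply: eq_bigr => a _.
  have := IHp (fun s => f (a :: s)) (fun b r => h b (a :: r))
            (alternating_cons a f_alt).
  rewrite -sumrMnl => IHa; under [X in _ = _ - X]eq_bigr do rewrite sumrMnl.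
  by rewrite -IHa -sumrB; apply: eq_bigr => t _; rewrite mulrBr.
rewrite [RHS]mulrS; congr (_ + _).
rewrite -sumrMnl exchange_big /= -sumrN; apply: eq_bigr => b _.
rewrite (sum_tuple_cons _ (fun s => f (b :: s) * h b s)) -sumrMnl -sumrN.
apply: eq_bigr => a _; rewrite -sumrMnl -sumrN; apply: eq_bigr => t _.
by rewrite (f_alt 0%N [:: b, a & t]) // mulNr mulNrn opprK.
Qed.

Lemma alternating_perm (T : eqType) (R : numDomainType) (f : seq T -> R) s t :
  alternating f -> perm_eq s t -> `|f s| = `|f t|.
Proof.
elim: s t f => [|a s IHs] t f f_alt st.
  by move: st; rewrite perm_sym => /perm_nilP ->.
have : a \in t by rewrite -(perm_mem st) mem_head.
move=> /path.splitPr at_; case: at_ st => t1 t2 st.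
rewrite (alternating_move _ _ _ f_alt) -mulrzr rmorphXn rmorphN1.
rewrite normrM normrX normrN1 expr1n mulr1.
apply: (IHs _ (fun s => f (a :: s))); first exact: alternating_cons.
by rewrite -(perm_cons a) (perm_trans st) // (perm_catCA t1 [:: a]).
Qed.

Lemma alternating_uniq (T : eqType) (R : numDomainType) (f : seq T -> R) s :
  alternating f -> ~~ uniq s -> f s = 0.
Proof.
elim: s f => [|a s IHs] f f_alt //=.
rewrite negb_and negbK => /orP[as_|/IHs]; last first.
  by move/(_ (fun s => f (a :: s))); apply; exact: alternating_cons.
apply/eqP; rewrite -normr_eq0.
rewrite (@alternating_perm _ _ _ _ [:: a, a & rem a s]) //; last first.
  by rewrite perm_cons perm_to_rem.
have := f_alt 0%N [:: a, a & rem a s] isT; move=> /= /eqP.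
by rewrite normr_eq0 -addr_eq0 -mulr2n mulrn_eq0.
Qed.

(** An alternating function is determined by its values on one word for each
subset of the letters ([alternating_perm], [alternating_uniq]), and these
values are arbitrary ([alternating_sign]). *)
Fixpoint inversions n (s : seq 'I_n) : nat :=
  if s is a :: s' then (count (fun b : 'I_n => b < a)%N s' + inversions s')%N
  else 0%N.

Lemma alternating_sign n (R : pzRingType) (g : {set 'I_n} -> R) :
  alternating (fun s : seq 'I_n => if uniq s
     then (-1) ^+ inversions s * g [set x in s] else 0).
Proof.
move=> k s ks; have ps := perm_swap k s; rewrite (perm_uniq ps).
case: ifP => [us|]; last by rewrite oppr0.
have -> : [set x in swap k s] = [set x in s].
  by apply/setP => x; rewrite !inE (perm_mem ps).
rewrite -mulNr; congr (_ * _).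
rewrite -signr_odd -[in RHS]signr_odd -signrN; congr ((-1) ^+ nat_of_bool _).
elim: k s ks us {ps} => [|k IHk] [|a s] //=.
  case: s => //= b s _; rewrite inE negb_or => /andP[/andP[ab _] _].
  case: (ltngtP a b) ab => [_ _|_ _|/val_inj->]; last by rewrite eqxx.
    by rewrite !oddD /=; do 3?case: (odd _).
  by rewrite !oddD /=; do 3?case: (odd _).
move=> ks /andP[_ us]; rewrite !oddD IHk // addbN; congr (~~ (odd _ (+) _)).
exact/permP/perm_swap.
Qed.

(** * Steps in the lattice *)

Notation lattice n := {ffun 'I_n -> 'Z_3}.

Definition unit_step (n : nat) (j : 'I_n) : lattice n := [ffun i => (i == j)%:R].

(** [merge k] is what the omission of the vertex of index k + 1 does to the
increments of a path. *)
Fixpoint merge (U : zmodType) (k : nat) (D : seq U) : seq U :=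
  match k, D with
  | 0, a :: b :: D' => (a + b) :: D'
  | k'.+1, a :: D' => a :: merge k' D'
  | _, _ => D
  end.

Section Steps.
Variable n : nat.
Implicit Types (i j : 'I_n) (d x y : lattice n) (J : seq 'I_n) (D : seq (lattice n)).

(** The homomorphism [level] tells apart 0, the unit steps and the sums of two unit
steps, on which it is 0, 1 and 2. *)
Definition level d : 'Z_3 := \sum_i d i.
Definition is_unit d := [exists j, d == unit_step j].
Definition steps J := map (@unit_step n) J.

Lemma is_unit_step j : is_unit (unit_step j).
Proof. by apply/existsP; exists j. Qed.

Lemma levelD x y : level (x + y) = level x + level y.
Proof. by rewrite -big_split; apply: eq_bigr => i _; rewrite ffunE. Qed.

Lemma level_step j : level (unit_step j) = 1.
Proof.
rewrite /level (bigD1 j) //= ffunE eqxx big1 ?addr0 // => i /negPf ij.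
by rewrite ffunE ij.
Qed.

Lemma unit_step_neq0 j : unit_step j != 0.
Proof.
apply/eqP => /(congr1 (level)); rewrite level_step /level big1 // => i _.
by rewrite ffunE.
Qed.

Lemma unit_step_inj : injective (@unit_step n).
Proof.
move=> i j /ffunP/(_ i); rewrite !ffunE eqxx.
by case: eqP.
Qed.

Lemma addr_step_neq0 i j : unit_step i + unit_step j != 0.
Proof.
apply/eqP => /(congr1 (level)); rewrite levelD !level_step /level big1 // => k _.
by rewrite ffunE.
Qed.

Lemma addr_step_not_unit i j : ~~ is_unit (unit_step i + unit_step j).
Proof.
by apply/existsP => -[k /eqP/(congr1 (level))]; rewrite levelD !level_step.
Qed.

Lemma addr_step_inj i j i' j' :
  unit_step i + unit_step j = unit_step i' + unit_step j' ->
  (i' = i /\ j' = j) \/ (i' = j /\ j' = i).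
Proof.
move=> eij.
have [ii'|ii'] := eqVneq i' i.
  by left; split=> //; move: eij; rewrite ii' => /addrI/unit_step_inj.
right; have [ji'|ji'] := eqVneq j' i.
  by split=> //; move: eij; rewrite ji' addrC => /addIr/unit_step_inj.
have /ffunP/(_ i) := eij; rewrite !ffunE eqxx.
rewrite ![i == _]eq_sym (negPf ii') (negPf ji').
by case: (j == i).
Qed.

Lemma merge_swap k J : merge k (steps (swap k J)) = merge k (steps J).
Proof. by elim: k J => [[|a [|b J]]|k IHk [|a J]] //=; rewrite ?IHk // addrC. Qed.

Lemma merge_steps_neq0 k J : all (fun d => d != 0) (merge k (steps J)).
Proof.
have stepsn J' : all (fun d => d != 0) (steps J').
  by apply/allP => d /mapP[j _ ->]; exact: unit_step_neq0.
elim: k J => [[|a [|b J]]|k IHk [|a J]] //=; rewrite ?unit_step_neq0 ?IHk //.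
by rewrite addr_step_neq0 stepsn.
Qed.

Lemma merge_steps_not_unit k J : (k.+1 < size J)%N ->
  ~~ all is_unit (merge k (steps J)).
Proof.
elim: k J => [[|a [|b J]]|k IHk [|a J]] //= kJ.
  by rewrite (negPf (addr_step_not_unit a b)).
by rewrite negb_and IHk ?orbT.
Qed.

(** The merged step is the only one that is not a unit step, which locates it,
and the sum of two unit vectors determines both of them up to order. *)
Lemma merge_steps_inj k k' J J' : (k.+1 < size J)%N -> (k'.+1 < size J')%N ->
  merge k (steps J) = merge k' (steps J') ->
  k = k' /\ (J' = J \/ J' = swap k J).
Proof.
elim: k k' J J' => [|k IHk] [|k'] [|a J] [|a' J'] //=.
- case: J J' => [|b J] [|b' J'] // _ _ [/addr_step_inj].
  by case=> -[-> ->] /(inj_map unit_step_inj) ->; split=> //; [left|right].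
- case: J => // b J _ _ [ab]; have := addr_step_not_unit a b.
  by rewrite ab is_unit_step.
- case: J' => // b J' _ _ [ab]; have := addr_step_not_unit a' b.
  by rewrite -ab is_unit_step.
by move=> kJ kJ' [/unit_step_inj ->] /IHk[] // -> [|] ->; split=> //; [left|right].
Qed.

End Steps.

(** * Harmonic analysis on the lattice *)

Section LatticeHarmonics.
Variable R : realFieldType.

(** The rows of this matrix are eigenvectors of the Laplacian of the 3-cycle with
eigenvalues 0, 3, 3, and [cowave1] is the transpose of its inverse. *)
Definition wave1 (c x : 'Z_3) : R :=
  if c == 0 then 1 else (x == c)%:R - (x == 0)%:R.

Definition cowave1 (c x : 'Z_3) : R :=
  if c == 0 then 3^-1 else (x == c)%:R - 3^-1.

Lemma Z3_cases (P : 'Z_3 -> Prop) : P 0 -> P 1 -> P (1 + 1) -> forall c, P c.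
Proof.
move=> P0 P1 P2 [[|[|[|c]]] c3] //.
- by rewrite (_ : Ordinal _ = 0) //; apply: val_inj.
- by rewrite (_ : Ordinal _ = 1) //; apply: val_inj.
by rewrite (_ : Ordinal _ = 1 + 1) //; apply: val_inj.
Qed.

Lemma sum_Z3 (F : 'Z_3 -> R) : \sum_c F c = F 0 + F 1 + F (1 + 1).
Proof.
rewrite !big_ord_recl big_ord0 addr0 addrA.
by congr (F _ + F _ + F _); apply: val_inj.
Qed.

Lemma wave1_lap c x :
  wave1 c x *+ 2 - wave1 c (x + 1) - wave1 c (x - 1) = 3 * (c != 0)%:R * wave1 c x.
Proof.
by elim/Z3_cases: c; elim/Z3_cases: x; rewrite /wave1 -!val_eqE /=; lra.
Qed.

Lemma sum_wave1_cowave1 c d : \sum_x wave1 c x * cowave1 d x = (c == d)%:R.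
Proof.
rewrite sum_Z3.
by elim/Z3_cases: c; elim/Z3_cases: d; rewrite /wave1 /cowave1 -!val_eqE /=; lra.
Qed.

Lemma sum_cowave1_wave1 x z : \sum_c cowave1 c x * wave1 c z = (x == z)%:R.
Proof.
rewrite sum_Z3.
by elim/Z3_cases: x; elim/Z3_cases: z; rewrite /wave1 /cowave1 -!val_eqE /=; lra.
Qed.

Variable n : nat.
Implicit Types (x y z : lattice n) (f : lattice n -> R).

Definition wave y x : R := \prod_j wave1 (y j) (x j).
Definition cowave y x : R := \prod_j cowave1 (y j) (x j).

Lemma prod_delta x y : \prod_j ((x j == y j)%:R : R) = (x == y)%:R.
Proof.
have [->|xy] := eqVneq x y; first by rewrite big1 // => j _; rewrite eqxx.
have /existsP[j xyj] : [exists j, x j != y j].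
  apply: contraNT xy => /existsPn xy; apply/eqP/ffunP => j.
  by apply/eqP; rewrite -[_ == _]negbK xy.
by rewrite (bigD1 j) //= (negPf xyj) mul0r.
Qed.

Lemma sum_wave_cowave y z : \sum_x wave y x * cowave z x = (y == z)%:R.
Proof.
rewrite -prod_delta.
under [RHS]eq_bigr do rewrite -sum_wave1_cowave1.
by rewrite bigA_distr_bigA /=; apply: eq_bigr => x _; rewrite -big_split.
Qed.

Lemma sum_cowave_wave x z : \sum_y cowave y x * wave y z = (x == z)%:R.
Proof.
rewrite -prod_delta.
under [RHS]eq_bigr do rewrite -sum_cowave1_wave1.
by rewrite bigA_distr_bigA /=; apply: eq_bigr => y _; rewrite -big_split.
Qed.

Definition frequency y : nat := #|[set j | y j != 0]|.

Lemma frequencyE y : (frequency y)%:R = \sum_j (y j != 0)%:R :> R.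
Proof.
rewrite /frequency -sum1dep_card natr_sum big_mkcond.
by apply: eq_bigr => j _; case: (y j != 0).
Qed.

Lemma wave_lap y x :
  \sum_j (wave y x *+ 2 - wave y (x + unit_step j) - wave y (x - unit_step j))
  = 3 * (frequency y)%:R * wave y x.
Proof.
rewrite frequencyE mulr_sumr mulr_suml; apply: eq_bigr => j _.
have shiftE d : wave y (x + d) = wave1 (y j) (x j + d j)
    * \prod_(i | i != j) wave1 (y i) (x i + d i).
  rewrite /wave (bigD1 j) //= ffunE; congr (_ * _).
  by apply: eq_bigr => i _; rewrite ffunE.
have restE d : (forall i, i != j -> d i = 0) ->
    \prod_(i | i != j) wave1 (y i) (x i + d i)
    = \prod_(i | i != j) wave1 (y i) (x i).
  by move=> d0; apply: eq_bigr => i /d0 ->; rewrite addr0.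
rewrite !shiftE !restE => [|i ij|i ij]; try by rewrite !ffunE (negPf ij) ?oppr0.
rewrite !ffunE eqxx /wave (bigD1 j) //= -mulrnAl -!mulrBl wave1_lap.
by rewrite mulrA.
Qed.

Definition lattice_lap (f : lattice n -> R) (y : lattice n) : R :=
  \sum_j (f y *+ 2 - f (y + unit_step j) - f (y - unit_step j)).

(** The lattice Laplacian is symmetric. *)
Lemma sum_wave_lap f y :
  \sum_x wave y x * lattice_lap f x
  = 3 * (frequency y)%:R * \sum_x wave y x * f x.
Proof.
rewrite mulr_sumr; under [RHS]eq_bigr do rewrite mulrA -wave_lap mulr_suml.
rewrite [RHS]exchange_big /=; under eq_bigr do rewrite mulr_sumr.
rewrite exchange_big; apply: eq_bigr => j _.
under eq_bigr do rewrite !mulrBr; under [RHS]eq_bigr do rewrite !mulrBl.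
rewrite !sumrB [RHS]addrAC; congr (_ - _); first congr (_ - _).
- by apply: eq_bigr => x _; rewrite mulrnAr mulrnAl.
- rewrite [RHS](reindex_inj (addIr (unit_step j))) /=.
  by apply: eq_bigr => x _; rewrite addrK.
rewrite [RHS](reindex_inj (addIr (- unit_step j))) /=.
by apply: eq_bigr => x _; rewrite addrNK.
Qed.
End LatticeHarmonics.

(** * The two halves of the Hodge Laplacian *)

Lemma scale_lfun_comp0 (K : fieldType) (vT : vectType K) (f g : 'End(vT))
    (a b : K) v : f (g v) = 0 -> (a *: f) ((b *: g) v) = 0.
Proof. by move=> fg; rewrite !scale_lfunE linearZ /= fg !scaler0. Qed.

Section Hodge.
Variables (R : realType) (G : digraph).

(** The weights p + 1 and p undo the normalisation of the inner product on
Omega_p: with them the sum of the two operators is, on the torus, the same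
difference operator in every degree. *)
Definition up_lap p : 'End(subvs_of (Omega R G p)) :=
  p.+1%:R *: (Omegabd R G p.+1 \o adjoint (Omegabd R G p.+1))%VF.
Definition down_lap p : 'End(subvs_of (Omega R G p)) :=
  p%:R *: (adjoint (Omegabd R G p) \o Omegabd R G p)%VF.

Lemma Omega_dot_eq0 p (u : subvs_of (Omega R G p)) :
  dot (vsval u) (vsval u) = 0 -> u = 0.
Proof. by move=> u0; apply: val_inj; exact: dot_eq0. Qed.

Lemma Omegabd_comp p (u : subvs_of (Omega R G p.+1)) :
  Omegabd R G p (Omegabd R G p.+1 u) = 0.
Proof.
apply: val_inj; change (vsval (Omegabd R G p (Omegabd R G p.+1 u)) = 0).
rewrite OmegabdE; have -> := OmegabdE u; exact: (bdK0 (vsval u)).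
Qed.

Lemma adjoint_comp p (u : subvs_of (Omega R G p.-1)) :
  adjoint (Omegabd R G p.+1) (adjoint (Omegabd R G p) u) = 0.
Proof.
apply: Omega_dot_eq0; set w := adjoint _ _; rewrite {2}/w.
have <- := adjointP (Omegabd R G p.+1); have <- := adjointP (Omegabd R G p).
by rewrite Omegabd_comp linear0 dotC linear0.
Qed.

Lemma up_down_lap p u : up_lap p (down_lap p u) = 0.
Proof.
by rewrite !scale_lfunE !comp_lfunE !linearZ /= adjoint_comp !linear0 ?scaler0.
Qed.

Lemma down_up_lap p u : down_lap p (up_lap p u) = 0.
Proof.
by rewrite !scale_lfunE !comp_lfunE !linearZ /= Omegabd_comp !linear0 ?scaler0.
Qed.

Lemma dim_leigenspace_down p (a : R) : a != 0 ->
  \dim (passmx.leigenspace (down_lap p.+1) a)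
  = \dim (passmx.leigenspace (up_lap p) a).
Proof.
move=> a0; rewrite !leigenspaceZ ?pnatr_eq0 //.
by apply: dim_leigenspace_comp; rewrite mulf_neq0 // invr_eq0 pnatr_eq0.
Qed.

Lemma down_lap0 : down_lap 0 = 0.
Proof. exact: scale0r. Qed.

Lemma hodgeE p : (0 < p)%N ->
  hodge R G p = p.+1%:R^-1 *: up_lap p + p%:R^-1 *: down_lap p.
Proof.
move=> p0; rewrite !scalerA !mulVf ?pnatr_eq0 -?lt0n // !scale1r.
by [].
Qed.

Lemma dim_leigenspace_hodge p (a : R) : (0 < p)%N -> a != 0 ->
  \dim (passmx.leigenspace (hodge R G p) a)
  = (\dim (passmx.leigenspace (up_lap p) (p.+1%:R * a))
     + \dim (passmx.leigenspace (down_lap p) (p%:R * a)))%N.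
Proof.
move=> p0 a0.
have ud (v : subvs_of (Omega R G p)) :=
  scale_lfun_comp0 p.+1%:R^-1 p%:R^-1 (up_down_lap v).
have du (v : subvs_of (Omega R G p)) :=
  scale_lfun_comp0 p%:R^-1 p.+1%:R^-1 (down_up_lap v).
rewrite (hodgeE p0).
apply: etrans (dim_leigenspaceD a0 ud du) _.
have p_neq0 : p%:R^-1 != 0 :> R by rewrite invr_eq0 pnatr_eq0 -lt0n.
have p1_neq0 : p.+1%:R^-1 != 0 :> R by rewrite invr_eq0 pnatr_eq0.
rewrite (leigenspaceZ (up_lap p) a p1_neq0).
rewrite (leigenspaceZ (down_lap p) a p_neq0).
rewrite !invrK.
by rewrite ![a * _]mulrC.
Qed.

Lemma dot_ge0 p (u : chain R G p) : 0 <= dot u u.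
Proof. by apply: sumr_ge0 => x _; exact: sqr_ge0. Qed.

(** Pairing with u gives a sum of two squares with positive weights. *)
Lemma ker_weighted_lap p (b c : R) u : 0 < b -> 0 < c ->
  (b *: up_lap p + c *: down_lap p) u = 0 -> up_lap p u = 0 /\ down_lap p u = 0.
Proof.
move=> b0 c0 /(congr1 (fun v => dot (vsval u) (vsval v))).
rewrite add_lfunE !scale_lfunE !comp_lfunE /= dotDr !dotZr.
have -> : dot (vsval u) (vsval (0 : subvs_of (Omega R G p))) = 0.
  by rewrite /dot big1 // => x _; rewrite ffunE mulr0.
have <- := adjointP (Omegabd R G p).
rewrite dotC; have -> := adjointP (Omegabd R G p.+1).
move/eqP; rewrite paddr_eq0 ?mulr_ge0 ?dot_ge0 ?ler0n 1?ltW // !mulf_eq0.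
rewrite (gt_eqF b0) (gt_eqF c0) !pnatr_eq0 /= => /andP[/eqP/Omega_dot_eq0 du pu].
rewrite du linear0 scaler0; split=> //.
case/orP: pu => [p0|/eqP/Omega_dot_eq0 ->]; last by rewrite linear0 scaler0.
have -> : p%:R = 0 :> R by apply/eqP; rewrite pnatr_eq0.
by rewrite scale0r.
Qed.

Lemma dim_ker_hodge p : (0 < p)%N ->
  \dim (passmx.leigenspace (hodge R G p) 0)
  = \dim (passmx.leigenspace (up_lap p + down_lap p) 0).
Proof.
move=> p0; congr (\dim _); apply/vspaceP => u.
rewrite !mem_leigenspace hodgeE // !scale0r.
have inv_gt0 q : (0 < q)%N -> 0 < q%:R^-1 :> R by rewrite invr_gt0 ltr0n.
apply/eqP/eqP.
  case/ker_weighted_lap; rewrite ?inv_gt0 // => u1 u2.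
  by rewrite add_lfunE u1 u2 addr0.
rewrite -[up_lap p]scale1r -[down_lap p]scale1r.
case/ker_weighted_lap => // u1 u2.
have scale0 (f : 'End(subvs_of (Omega R G p))) c : f u = 0 -> (c *: f) u = 0.
  by move=> fu; rewrite scale_lfunE fu scaler0.
by rewrite !scale1r add_lfunE (scale0 _ _ u1) (scale0 _ _ u2) addr0.
Qed.

End Hodge.

(** * Paths in a digraph with lattice coordinates *)

Section Walks.
Variables (n : nat) (G : digraph) (pt : lattice n -> G) (co : G -> lattice n).
Hypotheses (ptK : cancel pt co) (coK : cancel co pt).
Hypothesis arrow_pt : forall x y,
  arrow G (pt x) (pt y) = [exists j, y == x + unit_step j].
Implicit Types (x y : lattice n) (J : seq 'I_n) (D : seq (lattice n)).

(** Paths are encoded by a starting point and a sequence of increments. *)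
Fixpoint walk y D : seq G :=
  pt y :: if D is d :: D' then walk (y + d) D' else [::].

Lemma size_walk y D : size (walk y D) = (size D).+1.
Proof. by elim: D y => //= d D IHD y; rewrite IHD. Qed.

Lemma walk_inj y z D E : walk y D = walk z E -> y = z /\ D = E.
Proof.
elim: D y z E => [|d D IHD] y z [|e E] //= [/(can_inj ptK)->] //.
- by case: E.
- by case: D IHD.
by case/IHD => /addrI -> ->.
Qed.

Lemma allowed_walk y D : allowed (walk y D) = all (@is_unit n) D.
Proof.
rewrite /allowed; elim: D y => //= d D IHD y.
rewrite -(IHD (y + d)); case: D {IHD} => [|d' D] /=; rewrite arrow_pt; congr andb.
- by apply: eq_existsb => j; rewrite (inj_eq (addrI y)).
by apply: eq_existsb => j; rewrite (inj_eq (addrI y)).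
Qed.

Lemma regular_walk y D : regular (walk y D) = all (fun d => d != 0) D.
Proof.
rewrite /regular; elim: D y => //= d D IHD y.
rewrite -(IHD (y + d)); case: D {IHD} => [|d' D] /=; congr andb;
  by rewrite (can_eq ptK) -{1}[y]addr0 (inj_eq (addrI y)) eq_sym.
Qed.

Lemma allowed_steps y J : allowed (walk y (steps J)).
Proof.
by rewrite allowed_walk; apply/allP => d /mapP[j _ ->]; exact: is_unit_step.
Qed.

Lemma regular_steps y J : regular (walk y (steps J)).
Proof.
by rewrite regular_walk; apply/allP => d /mapP[j _ ->]; exact: unit_step_neq0.
Qed.

Lemma allowedP s : (0 < size s)%N -> allowed s ->
  exists y J, s = walk y (steps J).
Proof.
rewrite /allowed; elim: s => [|v [|w s] IHs] //= _.
  by exists (co v), [::]; rewrite /= coK.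
case/andP => + /(IHs isT) => + [y [J wE]]; rewrite wE.
rewrite -[v]coK (_ : w = pt y); last by case: J wE => [|? ?] [].
rewrite arrow_pt => /existsP[j /eqP yE].
by exists (co v), (j :: J); rewrite /= coK -yE.
Qed.

Lemma omit_first y d D : omit 0 (walk y (d :: D)) = walk (y + d) D.
Proof. by rewrite /omit take0 /= drop0. Qed.

Lemma omit_last y d D : omit (size D).+1 (walk y (rcons D d)) = walk y D.
Proof.
elim: D y => [|d' D IHD] y //=.
by rewrite -[RHS]/(pt y :: _) -IHD.
Qed.

Lemma omit_last_step p y J j : size J = p ->
  omit p.+1 (walk y (steps (rcons J j))) = walk y (steps J).
Proof. by move=> <-; rewrite /steps map_rcons -(size_map (@unit_step n)) omit_last. Qed.

Lemma omit_interior k y D : (k.+1 < size D)%N ->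
  omit k.+1 (walk y D) = walk y (merge k D).
Proof.
elim: k y D => [|k IHk] y [|d D] //=; last first.
  by move=> kD; rewrite -IHk.
by case: D => // d' D _; rewrite /omit /= drop0 addrA.
Qed.

Variable R : realType.

Lemma dot_epath p (u : chain R G p) (x : rpath G p) :
  dot u (epath R p (val (val x))) = u x.
Proof.
rewrite /dot (bigD1 x) //= ffunE eqxx mulr1 big1 ?addr0 // => z zx.
by rewrite ffunE !(inj_eq val_inj) (negPf zx) mulr0.
Qed.

Lemma rpathP p (s : seq G) : size s = p.+1 -> regular s ->
  exists x : rpath G p, val (val x) = s.
Proof.
move=> ss rs; have tP : size s == p.+1 by apply/eqP.
by exists (exist (fun t : p.+1.-tuple G => regular t) (Tuple tP) rs).
Qed.

Lemma dot_bd p (u : chain R G p.+1) (s : seq G) :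
  size s = p.+1 -> regular s ->
  dot (bd R G p.+1 u) (epath R p s)
  = \sum_x u x * \sum_(k < p.+2) (-1) ^+ k * (omit k (val (val x)) == s)%:R.
Proof.
move=> ss rs; have [z zs] := rpathP ss rs.
rewrite lfunE /= /bd_fun dotC -zs linear_sum /=; apply: eq_bigr => x _.
rewrite dotZr; congr (_ * _); rewrite linear_sum /=; apply: eq_bigr => k _.
by rewrite dotZr dotC dot_epath ffunE eq_sym.
Qed.

Lemma mem_Aspace p (u : chain R G p) :
  reflect (forall x : rpath G p, ~~ allowed (val (val x)) -> u x = 0)
          (u \in Aspace R G p).
Proof.
apply: (iffP idP) => [uA x nax|u0].
  rewrite (@coord_span _ _ _ (in_tuple _) _ uA) sum_ffunE big1 // => i _; rewrite ffunE.
  have /mapP[z] := mem_nth 0 (ltn_ord i : (i < size (in_tuple _))%N).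
  rewrite mem_filter => /andP[az _] ->; rewrite ffunE.
  case: eqP => [xz|_]; last by rewrite scaler0.
  by move: nax; rewrite xz az.
have -> : u = \sum_x (u x : R) *: epath R p (val (val x)).
  apply/ffunP => z; rewrite sum_ffunE (bigD1 z) //= !ffunE eqxx.
  rewrite [_ *: _]mulr1 big1 ?addr0 // => x xz; rewrite !ffunE.
  by rewrite !(inj_eq val_inj) eq_sym (negPf xz) scaler0.
apply: memv_suml => x _; case: (boolP (allowed (val (val x)))) => [ax|/u0->].
  apply/memvZ/memv_span/mapP; exists x => //.
  by rewrite mem_filter ax mem_enum.
by rewrite scale0r mem0v.
Qed.

Lemma size_walk_steps p y (t : p.-tuple 'I_n) :
  size (walk y (steps t)) == p.+1.
Proof. by rewrite size_walk size_map size_tuple. Qed.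

Definition walk_path p y (t : p.-tuple 'I_n) : rpath G p :=
  exist (fun t : p.+1.-tuple G => regular t) (Tuple (size_walk_steps y t))
    (regular_steps y t).

Lemma walk_steps_inj y z J K :
  walk y (steps J) = walk z (steps K) -> y = z /\ J = K.
Proof. by case/walk_inj => -> /(inj_map (@unit_step_inj n)). Qed.

Lemma sum_allowed p (F : rpath G p -> R) :
  (forall x : rpath G p, ~~ allowed (val (val x)) -> F x = 0) ->
  \sum_x F x = \sum_y \sum_(t : p.-tuple 'I_n) F (walk_path y t).
Proof.
move=> F0; pose h (z : lattice n * p.-tuple 'I_n) := walk_path z.1 z.2.
have h_inj : injective h.
  move=> [y s] [z t] /(congr1 val)/(congr1 val)/walk_steps_inj /= [-> st].
  by congr pair; apply: val_inj.
transitivity (\sum_(x in h @: setT) F x).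
  apply/esym/big_rmcond => x xh; apply: F0; apply: contraNN xh => ax.
  have [|y [J xE]] := allowedP _ ax; first by rewrite size_tuple.
  have sJ : size J == p.
    by have := size_tuple (val x); rewrite xE size_walk size_map => -[->].
  apply/imsetP; exists (y, Tuple sJ) => //.
  by apply: val_inj; apply: val_inj; rewrite xE.
rewrite pair_bigA big_imset /=; last by move=> ? ? _ _ /h_inj.
by apply: eq_bigl => z; rewrite inE.
Qed.

(** A total function of the word J, equal to 0 unless J has length p: this allows
the statements about alternating functions to be used without casts. *)
Definition path_coef p (u : chain R G p) y J : R :=
  dot u (epath R p (walk y (steps J))).

(** * Omega consists of the chains with alternating coefficients *)

Lemma path_coefE p (u : chain R G p) y (t : p.-tuple 'I_n) :
  path_coef u y t = u (walk_path y t).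
Proof. exact: (dot_epath u (walk_path y t)). Qed.

Lemma path_coef_size p (u : chain R G p) y J : size J != p -> path_coef u y J = 0.
Proof.
move=> Jp; rewrite /path_coef /dot big1 // => x _; rewrite ffunE.
case: eqP => [xJ|_]; last by rewrite mulr0.
have := size_tuple (val x); rewrite xJ size_walk size_map => -[/eqP].
by rewrite (negPf Jp).
Qed.

Lemma Aspace_dot p (u v : chain R G p) : u \in Aspace R G p ->
  dot u v = \sum_y \sum_(t : p.-tuple 'I_n) path_coef u y t * path_coef v y t.
Proof.
move=> /mem_Aspace uA; rewrite /dot sum_allowed => [|x /uA ->].
  by apply: eq_bigr => y _; apply: eq_bigr => t _; rewrite !path_coefE.
by rewrite mul0r.
Qed.

Lemma Aspace_path_coef_inj p (u v : chain R G p) :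
  u \in Aspace R G p -> v \in Aspace R G p ->
  (forall y (t : p.-tuple 'I_n), path_coef u y t = path_coef v y t) -> u = v.
Proof.
move=> uA vA uv; apply/subr0_eq/dot_eq0.
rewrite Aspace_dot ?memvB // big1 // => y _; rewrite big1 // => t _.
rewrite {1}/path_coef dotC dotBr !(dotC (epath _ _ _)) -!/(path_coef _ _ _).
by rewrite uv subrr mul0r.
Qed.

Definition chain_of p (f : lattice n -> seq 'I_n -> R) : chain R G p :=
  \sum_y \sum_(t : p.-tuple 'I_n) (f y t) *: epath R p (walk y (steps t)).

Lemma path_coef_chain_of p f y (t : p.-tuple 'I_n) :
  path_coef (chain_of p f) y t = f y t.
Proof.
rewrite path_coefE sum_ffunE (bigD1 y) //= [X in _ + X]big1 ?addr0 => [|z zy].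
  rewrite sum_ffunE (bigD1 t) //= [X in _ + X]big1 ?addr0 => [|s st].
    by rewrite !ffunE eqxx; exact: mulr1.
  rewrite !ffunE; case: eqP => [/walk_steps_inj[_ /val_inj ts]|_].
    by rewrite ts eqxx in st.
  by rewrite scaler0.
rewrite sum_ffunE big1 // => s _; rewrite !ffunE.
case: eqP => [/walk_steps_inj[yz _]|_]; last by rewrite scaler0.
by rewrite yz eqxx in zy.
Qed.

Lemma chain_of_Aspace p f : chain_of p f \in Aspace R G p.
Proof.
apply: memv_suml => y _; apply: memv_suml => t _; apply/memvZ/memv_span/mapP.
exists (walk_path y t) => //.
by rewrite mem_filter mem_enum andbT; exact: allowed_steps.
Qed.

Definition face p (u : chain R G p) (k : nat) (s : seq G) : R :=
  \sum_y \sum_(t : p.-tuple 'I_n)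
    path_coef u y t * (omit k (walk y (steps t)) == s)%:R.

Lemma bd_faces p (u : chain R G p.+1) s :
  u \in Aspace R G p.+1 -> size s = p.+1 -> regular s ->
  dot (bd R G p.+1 u) (epath R p s) = \sum_(k < p.+2) (-1) ^+ k * face u k s.
Proof.
move=> /mem_Aspace uA ss rs; rewrite dot_bd // sum_allowed => [|x /uA->];
  last by rewrite mul0r.
rewrite pair_bigA /=; under eq_bigr do rewrite mulr_sumr.
rewrite exchange_big /=; apply: eq_bigr => k _.
rewrite /face pair_bigA mulr_sumr; apply: eq_bigr => -[y t] _ /=.
by rewrite mulrCA path_coefE.
Qed.

Lemma face_first_not_allowed p (u : chain R G p.+1) s :
  ~~ allowed s -> face u 0 s = 0.
Proof.
move=> ns; rewrite /face big1 // => y _; rewrite big1 // => t _.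
case: eqP => [sE|_]; last by rewrite mulr0.
by move: ns; rewrite -sE (tuple_eta t) omit_first allowed_steps.
Qed.

Lemma face_last_not_allowed p (u : chain R G p.+1) s :
  ~~ allowed s -> face u p.+1 s = 0.
Proof.
move=> ns; rewrite /face big1 // => y _; rewrite big1 // => t _.
suff : allowed (omit p.+1 (walk y (steps t))).
  by case: eqP => [->|_]; rewrite ?(negPf ns) ?mulr0.
case: t => t /= /eqP; case/lastP: t => // t j; rewrite size_rcons => -[tp].
by rewrite omit_last_step // allowed_steps.
Qed.

Lemma face_interior p (u : chain R G p) k s :
  (k.+1 < p)%N ->
  face u k.+1 s = \sum_y \sum_(t : p.-tuple 'I_n)
                    path_coef u y t * (walk y (merge k (steps t)) == s)%:R.
Proof.
move=> kp; apply: eq_bigr => z _; apply: eq_bigr => t _.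
by rewrite omit_interior // size_map size_tuple.
Qed.

(** The faces of two paths that differ by exchanging the directions k and k + 1
are equal, so these contributions cancel in pairs. *)
Lemma face_alternating p (u : chain R G p) k s :
  (forall y, alternating (path_coef u y)) -> (k.+1 < p)%N -> face u k.+1 s = 0.
Proof.
move=> u_alt kp; rewrite face_interior // big1 // => y _.
set S := \sum_t _; suff : S = - S.
  by move/eqP; rewrite -addr_eq0 -mulr2n mulrn_eq0 /= => /eqP.
rewrite {1}/S (reindex_inj (h := fun t : p.-tuple 'I_n => [tuple of swap k t])).
  rewrite -sumrN; apply: eq_bigr => t _ /=.
  by rewrite merge_swap u_alt ?size_tuple // mulNr.
by move=> t t' /(congr1 val)/(can_inj (@swapK _ k))/val_inj.
Qed.

(** A face that is not allowed comes from at most two allowed paths, which have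
the same index k and differ by an exchange. *)
Lemma face_merge p (u : chain R G p) k k' y J :
  size J = p -> (k.+1 < p)%N -> (k'.+1 < p)%N ->
  face u k'.+1 (walk y (merge k (steps J)))
  = if k' == k
    then path_coef u y J + if swap k J == J then 0 else path_coef u y (swap k J)
    else 0.
Proof.
move=> sJ kp k'p; rewrite face_interior //; case: eqP => [->|k'k]; last first.
  rewrite big1 // => z _; apply: big1 => t _.
  case: eqP => [/walk_inj[_ /merge_steps_inj]|_]; last by rewrite mulr0.
  by rewrite sJ size_tuple => /(_ k'p kp)[/k'k].
have sJP : size J == p by apply/eqP.
pose T := Tuple sJP.
rewrite (bigD1 y) //= [X in _ + X]big1 ?addr0 => [|z zy]; last first.
  rewrite big1 // => t _; case: eqP => [/walk_inj[yz _]|_]; last by rewrite mulr0.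
  by rewrite yz eqxx in zy.
rewrite (bigD1 T) //= eqxx mulr1; congr (_ + _).
have other (t : p.-tuple 'I_n) : t != T -> t != [tuple of swap k T] ->
    path_coef u y t
    * (walk y (merge k (steps t)) == walk y (merge k (steps J)))%:R = 0.
  move=> tT tST; case: eqP => [|_]; last by rewrite mulr0.
  case/walk_inj => _ /esym/merge_steps_inj; rewrite sJ size_tuple => /(_ kp kp)[_].
  by case=> tJ; [case/eqP: tT|case/eqP: tST]; apply: val_inj.
case: eqP => [swJ|/eqP swJ].
  rewrite big1 // => t tT; apply: other => //.
  by rewrite (_ : [tuple of swap k T] = T) //; apply: val_inj.
rewrite (bigD1 [tuple of swap k T]) //=.
rewrite merge_swap eqxx mulr1 big1 ?addr0 // => t /andP[tT tST].
exact: other.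
Qed.

(** The coefficient of the boundary on the face of index k + 1 of the path (y; J)
is, up to sign, u(y; J) + u(y; swap k J), or u(y; J) alone if the two
exchanged directions are equal. *)
Lemma bd_in_Aspace p (u : chain R G p.+1) : u \in Aspace R G p.+1 ->
  bd R G p.+1 u \in Aspace R G p <-> forall y, alternating (path_coef u y).
Proof.
move=> uA; split=> [/mem_Aspace bdA y k J kJ|u_alt].
  have [sJ|sJ] := eqVneq (size J) p.+1; last first.
    by rewrite !path_coef_size ?size_swap ?oppr0.
  rewrite sJ in kJ.
  pose s := walk y (merge k (steps J)).
  have ns : ~~ allowed s.
    by rewrite allowed_walk merge_steps_not_unit // sJ.
  have rs : regular s by rewrite regular_walk merge_steps_neq0.
  have ss : size s = p.+1.
    rewrite /s -omit_interior ?size_map ?sJ //.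
    by rewrite size_omit size_walk size_map sJ //= ltnS ltnW.
  have [x xs] := rpathP ss rs.
  have := bd_faces uA ss rs; rewrite -{1}xs dot_epath bdA ?xs // => /esym.
  have k2 : (k.+1 < p.+2)%N by rewrite ltnW.
  rewrite (bigD1 (Ordinal k2)) //= big1 ?addr0; last first.
    case=> -[|k'] k'p /= k'k; first by rewrite face_first_not_allowed ?mulr0.
    rewrite -val_eqE /= eqSS in k'k; move/negPf: k'k => k'k.
    move: k'p; rewrite !ltnS leq_eqVlt => /orP[/eqP->|k'p].
      by rewrite face_last_not_allowed ?mulr0.
    by rewrite face_merge // k'k mulr0.
  rewrite face_merge // eqxx => /eqP; rewrite mulf_eq0 signr_eq0 /=.
  case: (swap k J =P J) => [->|_]; first by rewrite addr0 => /eqP ->; rewrite oppr0.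
  by rewrite addr_eq0 => /eqP ->; rewrite opprK.
apply/mem_Aspace => x nx; rewrite -dot_epath bd_faces ?size_tuple ?(valP x) //.
rewrite big1 // => -[[|k] kp] _ /=; first by rewrite face_first_not_allowed ?mulr0.
move: kp; rewrite !ltnS leq_eqVlt => /orP[/eqP->|kp].
  by rewrite face_last_not_allowed ?mulr0.
by rewrite face_alternating ?mulr0.
Qed.

Lemma bd0 (u : chain R G 0) : bd R G 0 u = 0.
Proof.
rewrite lfunE /= /bd_fun big1 // => x _; rewrite big1 ?scaler0 // => k _.
rewrite (_ : epath _ _ _ = 0) ?scaler0 //; apply/ffunP => z; rewrite !ffunE.
by case: eqP => // /(congr1 size); rewrite size_tuple size_omit ?size_tuple.
Qed.

Lemma mem_Omega p (u : chain R G p) :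
  u \in Omega R G p <->
  u \in Aspace R G p /\ forall y, alternating (path_coef u y).
Proof.
rewrite memv_cap -memv_preim; case: p u => [|p] u.
  rewrite bd0 mem0v andbT; split=> [uA|[]//]; split=> // y k J kJ.
  by rewrite !path_coef_size ?size_swap ?oppr0 //; case: J kJ.
split=> [/andP[uA bdA]|[uA u_alt]].
  by split=> //; exact/(bd_in_Aspace uA).
by rewrite uA; exact/(bd_in_Aspace uA).
Qed.

(** * Boundary, adjoint and Laplacian in coordinates *)

(** Only the first and the last faces are allowed; moving the last direction to
the front turns the sign of the last face into -1. *)
Lemma path_coef_bd p (u : chain R G p.+1) y (I : p.-tuple 'I_n) :
  u \in Omega R G p.+1 ->
  path_coef (bd R G p.+1 u) y I
  = \sum_j (path_coef u (y - unit_step j) (j :: I) - path_coef u y (j :: I)).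
Proof.
move=> /mem_Omega[uA u_alt].
rewrite {1}/path_coef bd_faces ?regular_steps ?size_walk ?size_map ?size_tuple //.
rewrite big_ord_recl big_ord_recr /= big1 ?add0r; last first.
  case=> k kp _; rewrite /= /bump leq0n add1n.
  by rewrite face_alternating ?mulr0.
rewrite expr0 mul1r sumrB; congr (_ + _).
  rewrite /face exchange_big /=.
  rewrite (sum_tuple_cons _ (fun s => \sum_z path_coef u z s
    * (omit 0 (walk z (steps s)) == walk y (steps I))%:R)).
  apply: eq_bigr => j _; rewrite exchange_big /=.
  rewrite (bigD1 (y - unit_step j)) //= [X in _ + X]big1 ?addr0; last first.
    move=> z zy; rewrite big1 // => t _; rewrite omit_first.
    case: eqP => [/walk_steps_inj[zjy _]|_]; last by rewrite mulr0.
    by rewrite -zjy addrK eqxx in zy.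
  rewrite (bigD1 I) //= omit_first addrNK eqxx mulr1 big1 ?addr0 // => t tI.
  rewrite /omit /= drop0; case: eqP => [/walk_steps_inj[_ /val_inj tIE]|_].
    by rewrite tIE eqxx in tI.
  by rewrite mulr0.
have -> : face u p.+1 (walk y (steps I)) = \sum_j path_coef u y (rcons I j).
  rewrite /face; under eq_bigr => z _ do
    rewrite (sum_tuple_rcons _ (fun s => path_coef u z s *
      (omit p.+1 (walk z (steps s)) == walk y (steps I))%:R)).
  rewrite (bigD1 y) //= [X in _ + X]big1 ?addr0; last first.
    move=> z zy; rewrite big1 // => t _; rewrite big1 // => j _.
    rewrite omit_last_step ?size_tuple //.
    case: eqP => [/walk_steps_inj[zE _]|_]; last by rewrite mulr0.
    by rewrite zE eqxx in zy.
  rewrite (bigD1 I) //= [X in _ + X]big1 ?addr0 => [|t tI].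
    by apply: eq_bigr => j _; rewrite omit_last_step ?size_tuple // eqxx mulr1.
  rewrite big1 // => j _; rewrite omit_last_step ?size_tuple //.
  case: eqP => [/walk_steps_inj[_ /val_inj tIE]|_]; last by rewrite mulr0.
  by rewrite tIE eqxx in tI.
rewrite mulr_sumr -sumrN; apply: eq_bigr => j _.
rewrite -cats1 (alternating_move _ _ _ (u_alt y)) cats0 size_tuple.
rewrite -mulrzr rmorphXn rmorphN1 mulrCA exprS mulN1r mulNr -expr2 sqrr_sign.
by rewrite mulrN1.
Qed.

Lemma path_coefD p (u v : chain R G p) y J :
  path_coef (u + v) y J = path_coef u y J + path_coef v y J.
Proof. exact: dotDl. Qed.

Lemma path_coefZ p a (u : chain R G p) y J :
  path_coef (a *: u) y J = a * path_coef u y J.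
Proof. by rewrite /path_coef dotC dotZr dotC. Qed.

Definition increment p (v : chain R G p) y j J : R :=
  path_coef v (y + unit_step j) J - path_coef v y J.

Lemma alternating_increment p (v : chain R G p) y j :
  v \in Omega R G p -> alternating (increment v y j).
Proof.
case/mem_Omega => _ v_alt k J kJ.
by rewrite /increment !v_alt // opprB opprK addrC.
Qed.

Lemma path_coef_chain_of_size p f y J :
  size J = p -> path_coef (chain_of p f) y J = f y J.
Proof. by move/eqP => sJ; exact: (path_coef_chain_of f y (Tuple sJ)). Qed.

Lemma chain_of_Omega p f :
  (forall y, alternating (f y)) -> chain_of p f \in Omega R G p.
Proof.
move=> f_alt; apply/mem_Omega; split=> [|y k J kJ]; first exact: chain_of_Aspace.
have [sJ|sJ] := eqVneq (size J) p; last by rewrite !path_coef_size ?size_swap ?oppr0.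
by rewrite !path_coef_chain_of_size ?size_swap ?f_alt.
Qed.

Lemma dot_bd_chain p (u : chain R G p.+1) (v : chain R G p) :
  u \in Omega R G p.+1 ->
  dot (bd R G p.+1 u) v *+ p.+1
  = dot u (chain_of p.+1 (fun y => del (increment v y))).
Proof.
move=> uO; have [uA u_alt] := (mem_Omega u).1 uO.
have bdA : bd R G p.+1 u \in Aspace R G p.
  by have /mem_Omega[] := bd_Omega uO.
rewrite !Aspace_dot //.
under [RHS]eq_bigr => y _.
  under eq_bigr => t _ do rewrite path_coef_chain_of.
  rewrite (sum_mul_del p (increment v y) (u_alt y)).
  over.
rewrite sumrMnl; congr (_ *+ _).
under eq_bigr => y _.
  under eq_bigr => t _ do rewrite path_coef_bd // mulr_suml.
  rewrite exchange_big /=; over.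
rewrite exchange_big [RHS]exchange_big /=; apply: eq_bigr => j _.
rewrite exchange_big [RHS]exchange_big /=; apply: eq_bigr => t _.
rewrite /increment; under eq_bigr do rewrite mulrBl.
under [RHS]eq_bigr do rewrite mulrBr.
rewrite !sumrB; congr (_ - _).
rewrite (reindex_inj (addIr (unit_step j))); apply: eq_bigr => y _.
by rewrite addrK.
Qed.

(** The right-hand side is alternating in J, hence defines an element of
Omega_(p+1), and it has the right inner products by [dot_bd_chain]. *)
Lemma path_coef_adjoint p (v : subvs_of (Omega R G p)) y J : size J = p.+1 ->
  p.+1%:R * path_coef (vsval (adjoint (Omegabd R G p.+1) v)) y J
  = del (increment (vsval v) y) J.
Proof.
move=> sJ; set w := adjoint _ v.
have wO : chain_of p.+1 (fun y => del (increment (vsval v) y)) \in Omega R G p.+1.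
  apply: chain_of_Omega => z; apply: alternating_del => j.
  exact/alternating_increment/subvsP.
suff wE : p.+1%:R *: vsval w = chain_of p.+1 (fun y => del (increment (vsval v) y)).
  by rewrite -path_coefZ wE path_coef_chain_of_size.
apply/subr0_eq/dot_eq0; set z := _ - _.
have zO : z \in Omega R G p.+1 by rewrite memvB // memvZ // subvsP.
rewrite {2}/z dotBr dotZr -dot_bd_chain // -(vsprojK zO).
rewrite -(adjointP (Omegabd R G p.+1)).
by rewrite OmegabdE mulr_natl subrr.
Qed.

Lemma val_Omegabd p (u : subvs_of (Omega R G p.+1)) :
  vsval (Omegabd R G p.+1 u : subvs_of (Omega R G p)) = bd R G p.+1 (vsval u).
Proof. exact (OmegabdE u). Qed.

(** The terms of [up_lap] in which the contracted direction j differs in position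
from the added one are the terms of [down_lap] with the opposite sign,
because the difference operators commute with their adjoints. *)
Lemma path_coef_lap p (u : subvs_of (Omega R G p)) y J : size J = p ->
  path_coef (vsval ((up_lap R G p + down_lap R G p) u)) y J
  = lattice_lap (fun z => path_coef (vsval u) z J) y.
Proof.
move=> sJ; have Jt : size J == p by apply/eqP.
set v := vsval u.
have upE : path_coef (vsval (up_lap R G p u)) y J
    = lattice_lap (fun z => path_coef v z J) y
      - \sum_j (del (fun i I => increment v (y - unit_step j) i (j :: I)) J
                - del (fun i I => increment v y i (j :: I)) J).
  rewrite /up_lap /down_lap scale_lfunE comp_lfunE /= path_coefZ.
  rewrite val_Omegabd.
  rewrite (path_coef_bd y (Tuple Jt)) ?subvsP // mulr_sumr -sumrB.
  apply: eq_bigr => j _; rewrite mulrBr !path_coef_adjoint /= ?sJ //.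
  rewrite /increment addrNK -/v.
  set a := del _ J; set b := del _ J; rewrite mulr2n; ring.
have downE : path_coef (vsval (down_lap R G p u)) y J
    = \sum_j (del (fun i I => increment v (y - unit_step j) i (j :: I)) J
                - del (fun i I => increment v y i (j :: I)) J).
  rewrite /up_lap /down_lap scale_lfunE comp_lfunE /= path_coefZ.
  clear upE; case: p u @v sJ Jt => [|p] u v sJ Jt.
    by rewrite mul0r; case: J sJ {Jt} => //= _; rewrite big1 // => j; rewrite subrr.
  rewrite path_coef_adjoint // -[RHS]/(\sum_j (_ + _)).
  under [RHS]eq_bigr => j _ do rewrite -delN -delD.
  rewrite -del_sum; apply: eq_del => i I /=; rewrite sJ => -[/eqP sI].
  rewrite /increment val_Omegabd !(path_coef_bd _ (Tuple sI)) ?subvsP // -sumrB.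
  apply: eq_bigr => j _ /=; rewrite [y - _ + _]addrAC -/v; ring.
by rewrite add_lfunE raddfD /= path_coefD upE downE addrNK.
Qed.

(** * Diagonalisation of the Laplacian on Omega *)

Definition subsets p : finType := {S : {set 'I_n} | #|S| == p}.

(** Wave coefficients in y, and values in J on the increasing words: coordinates on
Omega_p in which the Laplacian is diagonal. *)
Definition wave_transform p (u : subvs_of (Omega R G p)) :
    {ffun lattice n * subsets p -> R^o} :=
  [ffun z : lattice n * subsets p =>
     (\sum_x wave R z.1 x * path_coef (vsval u) x (enum (val z.2)) : R^o)].

Lemma wave_transform_linear p : linear (@wave_transform p).
Proof.
move=> a u v; apply/ffunP => z; rewrite !ffunE.
rewrite -[RHS]/(a * _ + _) mulr_sumr -big_split /=; apply: eq_bigr => x _.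
by rewrite path_coefD path_coefZ mulrDr mulrCA.
Qed.

HB.instance Definition _ p := GRing.isLinear.Build R (subvs_of (Omega R G p))
  {ffun lattice n * subsets p -> R^o} _ (@wave_transform p)
  (@wave_transform_linear p).

Lemma size_enum_subset p (S : subsets p) : size (enum (val S)) = p.
Proof. by rewrite -cardE; exact/eqP/(valP S). Qed.

Lemma wave_transform_inj p : injective (@wave_transform p).
Proof.
move=> u v uv; apply: val_inj; apply: Aspace_path_coef_inj.
- by have /mem_Omega[] := subvsP u.
- by have /mem_Omega[] := subvsP v.
move=> x t; apply/eqP; rewrite -subr_eq0.
have -> : path_coef (vsval u) x t - path_coef (vsval v) x t
    = path_coef (vsval (u - v)) x t.
  by rewrite raddfB /= path_coefD -scaleN1r path_coefZ mulN1r.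
have : wave_transform (u - v) = 0.
  by apply/eqP; rewrite raddfB subr_eq0; apply/eqP.
move: (u - v) => {uv v} {}u u0.
have /mem_Omega[_ /(_ x) u_alt] := subvsP u.
have path_coef0 (S : subsets p) : path_coef (vsval u) x (enum (val S)) = 0.
  have : \sum_y cowave R y x * wave_transform u (y, S) = 0.
    by rewrite u0 big1 // => y _; rewrite ffunE mulr0.
  under eq_bigr do rewrite ffunE mulr_sumr.
  rewrite exchange_big /= (bigD1 x) //= [X in _ + X]big1 ?addr0 => [|z zx].
    under eq_bigr do rewrite mulrA.
    by rewrite -mulr_suml sum_cowave_wave eqxx mul1r.
  under eq_bigr do rewrite mulrA.
  by rewrite -mulr_suml sum_cowave_wave eq_sym (negPf zx) mul0r.
case: (boolP (uniq t)) => [ut|/(alternating_uniq u_alt)->//].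
have tp : #|[set i in tval t]| == p.
  by rewrite cardsE (card_uniqP ut) size_tuple.
rewrite -normr_eq0.
have /(alternating_perm u_alt) -> : perm_eq t (enum [set i in tval t]).
  apply: uniq_perm => //; first exact: enum_uniq.
  by move=> i; rewrite mem_enum inE.
by rewrite (path_coef0 (exist (fun S : {set 'I_n} => #|S| == p) _ tp)) normr0.
Qed.

Lemma wave_transform_surj p (w : {ffun lattice n * subsets p -> R^o}) :
  exists u, wave_transform u = w.
Proof.
pose g x (S : {set 'I_n}) : R :=
  if @insub _ (fun S : {set 'I_n} => #|S| == p) (subsets p) S is Some S'
  then (-1) ^+ inversions (enum S) * \sum_y cowave R y x * w (y, S') else 0.
pose f x (s : seq 'I_n) : R :=
  if uniq s then (-1) ^+ inversions s * g x [set i in s] else 0.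
have fO : chain_of p f \in Omega R G p.
  by apply: chain_of_Omega => x; exact: alternating_sign.
exists (vsproj _ (chain_of p f)); apply/ffunP => -[y S]; rewrite ffunE vsprojK //=.
have fE x :
    path_coef (chain_of p f) x (enum (val S)) = \sum_z cowave R z x * w (z, S).
  rewrite path_coef_chain_of_size ?size_enum_subset // /f enum_uniq.
  have -> : [set i in enum (val S)] = val S by apply/setP => i; rewrite inE mem_enum.
  rewrite /g insubT ?(valP S) // => SP.
  rewrite (_ : Sub _ _ = S); last exact: val_inj.
  by rewrite mulrA -expr2 sqrr_sign mul1r.
under eq_bigr do rewrite fE mulr_sumr.
rewrite exchange_big /= (bigD1 y) //= [X in _ + X]big1 ?addr0 => [|z zy].
  under eq_bigr do rewrite mulrA.
  by rewrite -mulr_suml sum_wave_cowave eqxx mul1r.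
under eq_bigr do rewrite mulrA.
by rewrite -mulr_suml sum_wave_cowave eq_sym (negPf zy) mul0r.
Qed.

Lemma dim_leigenspace_lap p (a : R) :
  \dim (passmx.leigenspace (up_lap R G p + down_lap R G p) a)
  = (#|[set y : lattice n | (3 * (frequency y)%:R == a)%R]| * 'C(n, p))%N.
Proof.
pose mu (z : lattice n * subsets p) : R := 3 * (frequency z.1)%:R.
pose m (w : {ffun lattice n * subsets p -> R^o}) :
    {ffun lattice n * subsets p -> R^o} :=
  [ffun z : lattice n * subsets p => (mu z * w z : R^o)].
have m_lin : linear m.
  by move=> c v w; apply/ffunP => z; rewrite !ffunE mulrDr mulrCA.
pose mL := GRing.isLinear.Build _ _ _ _ m m_lin.
pose ml : {linear _ -> _} := HB.pack m mL.
rewrite (@dim_leigenspace_conj _ _ _ (linfun (@wave_transform p)) _ (linfun ml)).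
- rewrite (@dim_leigenspace_diag _ _ mu) => [|w z]; last by rewrite lfunE /= ffunE.
  rewrite (_ : [set z | mu z == a]
    = setX [set y | 3 * (frequency y)%:R == a] [set: subsets p]); last first.
    by apply/setP => z; rewrite !inE andbT.
  rewrite cardsX cardsT card_sig; congr muln.
  by have := card_draws 'I_n p; rewrite card_ord cardsE.
- by move=> u v; rewrite !lfunE; exact: wave_transform_inj.
- by move=> w; have [u <-] := wave_transform_surj w; exists u; rewrite lfunE.
move=> u; rewrite (lfunE (@wave_transform p)) (lfunE (@wave_transform p)) (lfunE ml).
apply/ffunP => -[y S]; rewrite !ffunE /=.
rewrite -sum_wave_lap; apply: eq_bigr => x _.
by rewrite path_coef_lap ?size_enum_subset.
Qed.

End Walks.

(** * The torus *)

(** Choose the support, then one of two nonzero values at each of its points. *)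
Lemma card_frequency n k :
  #|[set y : lattice n | frequency y == k]| = (2 ^ k * 'C(n, k))%N.
Proof.
pose supp (y : lattice n) := [set j | y j != 0].
rewrite -sum1dep_card (partition_big supp (fun S : {set 'I_n} => #|S| == k)) //=.
have card_supp (S : {set 'I_n}) : #|S| = k ->
    (\sum_(y | (frequency y == k) && (supp y == S)) 1 = 2 ^ k)%N.
  move=> Sk; have := card_pffun_on (0 : 'Z_3) (mem S) (predC1 (0 : 'Z_3)).
  rewrite cardC1 card_ord Sk => <-; rewrite sum1dep_card; apply: eq_card => y.
  rewrite !inE; apply/andP/pffun_onP => [[_ /eqP <-]|[/subsetP yS ySn]].
    split=> [|c /imageP[j]]; first by apply/subsetP => j; rewrite !inE.
    by rewrite !inE => yj ->.
  suff yS' : supp y = S by rewrite yS' -Sk -yS' !eqxx.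
  apply/setP => j; rewrite inE; apply/idP/idP => [yj|jS]; first exact: yS.
  by have := ySn (y j) (image_f y jS); rewrite inE.
rewrite (eq_bigr (fun=> 2 ^ k)%N) => [|S /eqP/card_supp//].
rewrite sum_nat_cond_const mulnC; congr muln.
by have := card_draws 'I_n k; rewrite card_ord => <-; rewrite cardsE.
Qed.

Lemma card_eigenfrequency (R : numDomainType) n (a : R) :
  #|[set y : lattice n | 3 * (frequency y)%:R == a]|
  = (\sum_(k < n.+1) (if (3 * k%:R == a)%R then 2 ^ k * 'C(n, k) else 0))%N.
Proof.
have freq_lt (y : lattice n) : (frequency y < n.+1)%N.
  by rewrite ltnS -[X in (_ <= X)%N]card_ord max_card.
rewrite -sum1dep_card.
rewrite (partition_big (fun y => Ordinal (freq_lt y)) xpredT) //=.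
apply: eq_bigr => k _; case: eqP => [ka|nka].
  rewrite -card_frequency -sum1dep_card; apply: eq_bigl => y.
  rewrite -val_eqE /=; case: (frequency y =P k) => [->|_]; last by rewrite andbF.
  by rewrite ka eqxx.
by rewrite big1 // => y /andP[/eqP ya /eqP yk]; case: nka; rewrite -yk.
Qed.

Lemma cyc3_arrow_step (c d : 'Z_3) : arrow cyc3 c d = (d == c + 1).
Proof. by elim/Z3_cases: c; elim/Z3_cases: d. Qed.

Lemma torus_coordinates n : (0 < n)%N ->
  exists (pt : lattice n -> torus n) (co : torus n -> lattice n),
  [/\ cancel pt co, cancel co pt & forall x y,
    arrow (torus n) (pt x) (pt y) = [exists j, y == x + unit_step j]].
Proof.
case: n => // n _; rewrite /torus /=; elim: n => [|n [pt [co [ptK coK ptE]]]].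
  exists (fun x => x ord0), (fun c => [ffun=> c]).
  split=> [x|c|x y]; first by apply/ffunP => i; rewrite ffunE (ord1 i).
    by rewrite ffunE.
  have -> : [exists j, y == x + unit_step j] = (y ord0 == x ord0 + 1).
    apply/existsP/eqP => [[j /eqP ->]|yx]; first by rewrite !ffunE (ord1 j).
    by exists ord0; apply/eqP/ffunP => i; rewrite !ffunE (ord1 i).
  exact: cyc3_arrow_step.
(* The coordinate of the last factor comes first, so that [lift ord0] and
   [unlift ord0] give access to the others. *)
pose pt' (x : lattice n.+2) := (pt [ffun i => x (lift ord0 i)], x ord0).
pose co' (v : iter n (box^~ cyc3) cyc3 * cyc3) : lattice n.+2 :=
  [ffun i => oapp (co v.1) v.2 (unlift ord0 i)].
exists pt', co'; split=> [x|[v c]|x y].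
- apply/ffunP => i; rewrite ffunE /= ptK; case: unliftP => [j ->|->] //=.
  by rewrite ffunE.
- rewrite /pt' /co' ffunE unlift_none /=; congr pair.
  rewrite -[RHS]coK; congr pt; apply/ffunP => i.
  by rewrite !ffunE liftK.
pose tl (x : lattice n.+2) : lattice n.+1 := [ffun i => x (lift ord0 i)].
have lattice_eq (v w : lattice n.+2) : (v == w) = (tl v == tl w) && (v ord0 == w ord0).
  apply/eqP/andP => [->|[/eqP/ffunP vw /eqP vw0]]; first by rewrite !eqxx.
  apply/ffunP => i; case: (unliftP ord0 i) => [j ->|-> //].
  by have := vw j; rewrite !ffunE.
have step0 : tl (x + unit_step ord0) = tl x.
  by apply/ffunP => i; rewrite !ffunE eq_sym (negPf (neq_lift _ _)) addr0.
have stepS j : tl (x + unit_step (lift ord0 j)) = tl x + unit_step j.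
  by apply/ffunP => i; rewrite !ffunE (inj_eq lift_inj).
have -> : [exists j, y == x + unit_step j]
    = (y == x + unit_step ord0) || [exists j, y == x + unit_step (lift ord0 j)].
  apply/existsP/orP => [[j]|[yx|/existsP[j yx]]]; last 2 first.
  - by exists ord0.
  - by exists (lift ord0 j).
  case: (unliftP ord0 j) => [i ->|->] yx; last by left.
  by right; apply/existsP; exists i.
rewrite lattice_eq step0 !ffunE eqxx -cyc3_arrow_step; congr (_ || _).
  by rewrite [LHS]/= (can_eq ptK) eq_sym.
rewrite [LHS]/= ptE andbC; apply/andP/existsP => [[/eqP xy0 /existsP[j yx]]|[j]].
  by exists j; rewrite lattice_eq stepS yx !ffunE xy0 /= addr0 eqxx.
rewrite lattice_eq stepS !ffunE /= addr0 => /andP[yx /eqP ->]; split=> //.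
by apply/existsP; exists j.
Qed.

Section TorusSpectrum.
Variables (R : realType) (n : nat).
Hypothesis n_gt0 : (0 < n)%N.

Definition frequency_mult (a : R) : nat :=
  #|[set y : lattice n | 3 * (frequency y)%:R == a]|.

Lemma dim_leigenspace_torus_lap p (a : R) :
  \dim (passmx.leigenspace (up_lap R (torus n) p + down_lap R (torus n) p) a)
  = (frequency_mult a * 'C(n, p))%N.
Proof.
have [pt [co [ptK coK ptE]]] := torus_coordinates n_gt0.
exact: (dim_leigenspace_lap ptK coK ptE).
Qed.

(** Induction on p: the multiplicity in the sum of the two halves is known, and
the one in [down_lap] is the one in [up_lap] one degree below. *)
Lemma dim_leigenspace_torus_up p (a : R) : a != 0 ->
  \dim (passmx.leigenspace (up_lap R (torus n) p) a)
  = (frequency_mult a * 'C(n.-1, p))%N.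
Proof.
move=> a0; have split q := dim_leigenspaceD a0
  (@up_down_lap R (torus n) q) (@down_up_lap R (torus n) q).
elim: p => [|p IHp].
  have := split 0%N; rewrite dim_leigenspace_torus_lap !bin0 => ->.
  rewrite down_lap0 [X in (_ + X)%N](_ : _ = 0%N) ?addn0 //.
  apply/eqP; rewrite dimv_eq0; apply/eqP/vspaceP => u.
  rewrite mem_leigenspace zero_lfunE eq_sym scaler_eq0 (negPf a0) memv0.
  by [].
have := split p.+1; rewrite dim_leigenspace_torus_lap dim_leigenspace_down // IHp.
rewrite -{1}(prednK n_gt0) binS mulnDr.
by move=> /addIn ->.
Qed.

Lemma spec_hodge_torus p (a : R) : (0 < p)%N ->
  spec (hodge R (torus n) p) a
  = (frequency_mult (p%:R * a) * 'C(n.-1, p.-1)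
     + frequency_mult (p.+1%:R * a) * 'C(n.-1, p))%N.
Proof.
case: p => // p _; rewrite specE.
have [->|a0] := eqVneq a 0.
  rewrite dim_ker_hodge // dim_leigenspace_torus_lap !mulr0.
  by rewrite -{1}(prednK n_gt0) binS mulnDr addnC.
rewrite dim_leigenspace_hodge // dim_leigenspace_down ?mulf_neq0 ?pnatr_eq0 //.
by rewrite !dim_leigenspace_torus_up ?mulf_neq0 ?pnatr_eq0 // addnC.
Qed.

End TorusSpectrum.

Lemma frequency_multE (R : realType) n p m (a : R) : (0 < p)%N ->
  (\big[msetD/mset0]_(k < n.+1)
     msetn (2 ^ k * 'C(n, k) * m)%N (3 * k%:R / p%:R : R)) a
  = (frequency_mult n (p%:R * a) * m)%N.
Proof.
move=> p0; rewrite (big_morph (fun M : {mset R} => M a)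
  (fun A B => (msetE2 A B a).1.1.1) (mset0E a)).
rewrite /frequency_mult card_eigenfrequency big_distrl /=.
apply: eq_bigr => k _; rewrite msetnE.
have -> : (a == 3 * k%:R / p%:R) = (3 * k%:R == p%:R * a :> R).
  have p_neq0 : p%:R != 0 :> R by rewrite pnatr_eq0 -lt0n.
  by rewrite eq_sym -(inj_eq (mulIf p_neq0)) divfK // [a * _]mulrC.
by case: ifP.
Qed.

Lemma frequency_mult_nat (R : realType) n k :
  frequency_mult n (3 * k%:R : R) = (2 ^ k * 'C(n, k))%N.
Proof.
rewrite -card_frequency; apply: eq_card => y; rewrite !inE.
by rewrite (inj_eq (mulfI _)) ?pnatr_eq0 // eqr_nat.
Qed.

Lemma frequency_mult_bounds (R : realType) n (a : R) :
  frequency_mult n a != 0%N -> 0 <= a <= 3 * n%:R.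
Proof.
rewrite -lt0n card_gt0 => /set0Pn[y]; rewrite inE => /eqP <-.
rewrite mulr_ge0 ?ler0n // ler_pM2l ?ltr0n // ler_nat.
by rewrite -[X in (_ <= X)%N]card_ord max_card.
Qed.

Lemma leigenvalue_spec (R : realType) (vT : vectType R) (f : 'End(vT)) (a : R) :
  passmx.leigenvalue f a = (spec f a != 0%N).
Proof. by rewrite specE dimv_eq0. Qed.

Theorem theorem8p2 (R : realType) (n p : nat) (hp : (1 <= p <= n)%N) :
  [/\ spec (hodge R (torus n) p) =
        (\big[msetD/mset0]_(k < n.+1)
           msetn (2 ^ k * 'C(n, k) * 'C(n.-1, p.-1))%N
                 (3 * k%:R / p%:R : R))
        `+`
        (\big[msetD/mset0]_(k < n.+1)
           msetn (2 ^ k * 'C(n, k) * 'C(n.-1, p))%N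
                 (3 * k%:R / p.+1%:R : R)),
      lambda_max_is (hodge R (torus n) p)
        (3 * n%:R / p%:R) (2 ^ n * 'C(n.-1, p.-1))%N
    & lambda_min_is (hodge R (torus n) p) 0 'C(n, p)%N].
Proof.
have [p_gt0 p_le_n] := andP hp.
have n_gt0 := leq_trans p_gt0 p_le_n.
have specE_torus (a : R) := spec_hodge_torus n_gt0 a p_gt0.
have p_pos : 0 < p%:R :> R by rewrite ltr0n.
have bin_gt0' : (0 < 'C(n.-1, p.-1))%N by rewrite bin_gt0 -ltnS !prednK.
have spec_max : spec (hodge R (torus n) p) (3 * n%:R / p%:R)
    = (2 ^ n * 'C(n.-1, p.-1))%N.
  rewrite specE_torus [p%:R * _]mulrC divfK ?gt_eqF // frequency_mult_nat binn muln1.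
  rewrite [X in (_ + X * _)%N](_ : _ = 0%N) ?addn0 //.
  apply: contraTeq isT => /frequency_mult_bounds/andP[_].
  rewrite -natr1 mulrDl mul1r [p%:R * _]mulrC divfK ?gt_eqF // gerDl.
  by rewrite leNgt divr_gt0 // mulr_gt0 ?ltr0n.
have spec_min : spec (hodge R (torus n) p) 0 = 'C(n, p)%N.
  rewrite specE_torus !mulr0 -[X in frequency_mult n X](mulr0 (3 : R)).
  rewrite (frequency_mult_nat R n 0) expn0 bin0 !mul1n.
  by case: p p_gt0 {hp p_le_n specE_torus p_pos bin_gt0' spec_max} => // q _;
    rewrite -[in RHS](prednK n_gt0) binS addnC.
have eigen_bounds b : passmx.leigenvalue (hodge R (torus n) p) b ->
    0 <= b <= 3 * n%:R / p%:R.
  rewrite leigenvalue_spec specE_torus addn_eq0 negb_and !muln_eq0 !negb_or.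
  rewrite ler_pdivlMr //.
  case/orP => /andP[/frequency_mult_bounds/andP[b0 bn] _].
    by rewrite -(pmulr_rge0 _ p_pos) b0 mulrC.
  have b_ge0 : 0 <= b by rewrite -(pmulr_rge0 b (ltr0Sn R p)).
  rewrite b_ge0 (le_trans _ bn) // mulrC ler_wpM2r // ler_nat leqnSn.
  by [].
split.
- by apply/msetP => a; rewrite msetE2 !frequency_multE.
- split=> // [|b /eigen_bounds/andP[]//].
  by rewrite leigenvalue_spec spec_max muln_eq0 negb_or expn_eq0 -!lt0n bin_gt0'.
split=> // [|b /eigen_bounds/andP[]//].
by rewrite leigenvalue_spec spec_min -lt0n bin_gt0.
Qed.
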